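(* Let $M>0$, let $l\ge 2$ be an integer, and let $K=lM$. Let $\{X(i)\}_{i\ge 0}$ be i.i.d. exponentially distributed with probability density function $f(x)=\lambda e^{-\lambda x}$, $x\ge 0$, where $\lambda=1/\bar X$, $\bar X=\mathbb{E}[X(i)]$, and put $\delta=\lambda M$. Consider the finite-capacity storage process $$B(i+1)=\min\!\left(B(i)-M\,\mathds{1}_{B(i)>M}+X(i),\,K\right)$$ on $[0,K]$. Then the limiting probability density function $g(x)$ of the energy buffer content on $(0,K)$ and the limiting full buffer probability $\pi(K)$ satisfy the following. For $0\le x<M$, $$g(x)=\pi(K)\,\lambda\, e^{-\delta(1-l)}\sum_{q=0}^{l-2}\frac{e^{-\delta q}}{q!}\Big[\left(\delta(q+1)-\lambda K\right)^{q}-e^{-\lambda x}\left(\delta(q+1)+\lambda(x-K)\right)^{q}\Big];$$ for $n=0,\dots,l-2$ and $K-(n+1)M\le x<K-nM$, $$g(x)=\pi(K)\,\lambda\, e^{-\lambda(x-K)}\left[1+\sum_{q=1}^{n}\frac{e^{-\delta q}}{(q-1)!}\left(\delta q+\lambda(x-K)\right)^{q-1}\left(\frac{\lambda(x-K)}{q}+\delta-1\right)\right];$$ and $$\begin{aligned}\pi(K)=\Bigg\{&1+\sum_{n=0}^{l-2}e^{n\delta}\sum_{q=0}^{n}\frac{\left(\delta e^{-\delta}\right)^q}{q!}\left(e^{\delta}\left(q-(n+1)\right)^q-(q-n)^q\right)\\&+e^{-\delta(1-l)}\sum_{q=0}^{l-2}\frac{e^{-\delta q}}{q!}\Big[e^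{\delta(q+1-l)}\big(\Gamma(q+1,\delta(q+2-l))-\Gamma(q+1,\delta(q+1-l))\big)+\delta\left(\delta(q+1-l)\right)^q\Big]\Bigg\}^{-1}.\end{aligned}$$
   Context: $\mathds{1}_A$ equals $1$ if the event $A$ holds and $0$ otherwise. $\Gamma(q+1,z)=\int_z^\infty t^{q}e^{-t}\,dt$ is the upper incomplete gamma function (here $q\ge 0$ is an integer and $z$ is real, possibly negative). The convention $0^0=1$ is used, and empty sums equal $0$. The initial content is independent of the sequence $\{X(i)\}$, so $X(i)$ is independent of $B(i)$. A stationary distribution of a Markov chain is a distribution such that if the chain starts with this distribution, it remains in this distribution. A limiting distribution is a stationary distribution to which the chain converges asymptotically from some initial distribution. For this process the chain has a unique stationary distribution, to which it converges in total variation from any initial distribution; this limiting distribution consists of a density $g$ (with respect to Lebesgue measure) on $(0,K)$ and an atom of mass $\pi(K)$ at $K$. *)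

(* Defs.v *)
From HB Require Import structures.
From mathcomp Require Import all_boot all_order all_algebra.
From mathcomp Require Import all_classical all_reals all_analysis.

Set Implicit Arguments.
Unset Strict Implicit.
Unset Printing Implicit Defensive.

Import Order.TTheory GRing.Theory Num.Theory.
Import numFieldNormedType.Exports.

Local Open Scope classical_set_scope.
Local Open Scope ring_scope.

(* The boolean [M < b] is coerced to 0 or 1. *)
Definition storage_step (R : realType) (M K b x : R) : R :=
  Num.min (b - M * (M < b)%R%:R + x) K.

(* Mutual independence of a countable family of real random variables:
   the product rule for every finite subfamily. *)
Definition mutually_independent d (T : measurableType d) (R : realType)
    (P : probability T R) (Z : nat -> {RV P >-> R}) : Prop :=
  forall (s : seq nat) (A : nat -> set R), uniq s ->
    (forall i, measurable (A i)) ->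
    P (\bigcap_(i in [set` s]) (Z i @^-1` A i)) =
      (\prod_(i <- s) P (Z i @^-1` A i))%E.

(* The family Z, X 0, X 1, ...: its mutual independence says that the X i are
   independent and that Z is independent of the sequence X. *)
Definition cons_family (A : Type) (Z : A) (X : nat -> A) (i : nat) : A :=
  if i is j.+1 then X j else Z.

(* Transition probabilities of the chain b |-> storage_step M K b X with X
   exponentially distributed. *)
Definition storage_kernel (R : realType) (M K lambda b : R) (A : set R)
    : \bar R :=
  exponential_prob lambda (storage_step M K b @^-1` A).

Definition stationary (R : realType) (M K lambda : R) (mu : probability R R)
    : Prop :=
  mu `[0, K]%classic = 1%E /\
  forall A : set R, measurable A ->
    (\int[mu]_b storage_kernel M K lambda b A)%E = mu A.

Definition tv_dist (R : realType) (mu nu : probability R R) : R :=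
  sup [set `|fine (mu A) - fine (nu A)| | A in (measurable : set (set R))].

Definition has_density_and_atom (R : realType) (K : R) (mu : probability R R)
    (g : R -> R) (piK : R) : Prop :=
  [/\ measurable_fun `]0, K[ g,
      forall x : R, 0 < x < K -> 0 <= g x &
      forall A : set R, measurable A ->
        mu A = (\int[lebesgue_measure]_(x in A `&` `]0%R, K[) (g x)%:E
                + piK%:E * \d_K A)%E].

(* The upper incomplete gamma function Gamma(s, z) for an integer s >= 1;
   z may be negative. *)
Definition upper_gamma (R : realType) (s : nat) (z : R) : R :=
  \int[lebesgue_measure]_(t in `[z, +oo[) (t ^+ s.-1 * expR (- t)).

(* Main.v *)
Require Import Defs.
From HB Require Import structures.
From mathcomp Require Import all_boot all_order all_algebra.
From mathcomp Require Import all_classical all_reals all_analysis.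
From mathcomp Require Import measurable_realfun ring lra zify.

(* Let F x be the mass of [x, K] under the stationary law, divided by the mass
   of the atom at K. Level crossing at x gives the density
   lambda (F (max x M) - F (x + M)) with F = 0 beyond K, so that on [M, K] the
   function F solves the delay equation F' x = - lambda (F x - F (x + M)),
   F K = 1, whose solution is a sum of truncated powers
   (delta q + lambda (x - K))^q times exponentials. A Gronwall argument cell by
   cell shows that F is nonincreasing, so the density is nonnegative.
   Stationarity is checked on the
   rays ]x, oo[, where the integral of the transition probability has explicit
   antiderivatives: exp (lambda x) (F (x - M) - F x) on [M, K] and
   exp (lambda x) (F M - F x) on [0, M], F being continued below M by the same
   formula.
   From every content the buffer is full after one slot with probability at
   least exp (- lambda K), so one step contracts the total variation distance by
   1 - exp (- lambda K); this gives uniqueness and convergence. *)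

Set Implicit Arguments.
Unset Strict Implicit.
Unset Printing Implicit Defensive.

Import Order.TTheory GRing.Theory Num.Theory.
Import numFieldNormedType.Exports.

Local Open Scope classical_set_scope.
Local Open Scope ring_scope.

(** * Derivatives and integrals *)

Section derivatives.
Context {R : realType}.
Implicit Types (f g : R -> R) (a b c x : R).

(** Level crossing only suggests the density; no step below relies on it. What is proved is that the
    candidate is a probability and that one step of the chain preserves it. The first point is not
    visible from the formulas: on each cell of length [M] the powers in F have nonpositive bases, so
    the terms alternate in sign, and nonnegativity has to come from the delay equation itself. The
    antiderivatives are explicit because of a cancellation: in the derivative of exp (lambda x) (F
    (x - M) - F x), the delay equation at x - M produces - lambda (F (x - M) - F x), which is
    exactly what differentiating the exponential adds. Below [M] the continued F is no longer a
    mass; its values there only serve as boundary terms and drop out of the balance. Uniqueness is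
    not read off the delay equation, because a competing stationary law need not have a density. The
    contraction applies to every law on [0, K]. *)

Lemma is_derive_ext f g x a :
  f =1 g -> is_derive x 1 f a -> is_derive x 1 g a.
Proof. by move=> /funext ->. Qed.

Lemma is_derive_add f g x a b : is_derive x 1 f a -> is_derive x 1 g b ->
  is_derive x 1 (fun x => f x + g x) (a + b).
Proof. by move=> fa gb; exact: (@is_deriveD _ _ _ f g). Qed.

Lemma is_derive_mul f g x a b : is_derive x 1 f a -> is_derive x 1 g b ->
  is_derive x 1 (fun x => f x * g x) (a * g x + f x * b).
Proof.
move=> fa gb; have := @is_deriveM _ _ f g x 1 a b fa gb.
by rewrite /GRing.scale/= addrC (mulrC (g x)).
Qed.

Lemma is_derive_const c x : is_derive x 1 (fun=> c) 0.
Proof. exact: is_derive_cst. Qed.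

Lemma is_derive_mulr f c x a :
  is_derive x 1 f a -> is_derive x 1 (fun x => f x * c) (a * c).
Proof.
move=> fa; rewrite -[a * c]addr0 -[X in _ + X](mulr0 (f x)).
exact: is_derive_mul fa (is_derive_const c x).
Qed.

Lemma is_derive_mull f c x a :
  is_derive x 1 f a -> is_derive x 1 (fun x => c * f x) (c * a).
Proof.
move=> fa; under eq_fun do rewrite mulrC.
by rewrite mulrC; exact: is_derive_mulr.
Qed.

Lemma is_derive_affine a b x : is_derive x 1 (fun x => a * x + b) a.
Proof.
have := is_derive_add (is_derive_mull a (is_derive_id x 1))
  (is_derive_const b x).
by rewrite addr0 mulr1.
Qed.

Lemma is_derive_exp f x a : is_derive x 1 f a ->
  is_derive x 1 (fun x => expR (f x)) (a * expR (f x)).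
Proof.
by move=> fa; rewrite mulrC; exact: (@is_derive1_comp _ expR f).
Qed.

Lemma is_derive_expr f n x a : is_derive x 1 f a ->
  is_derive x 1 (fun x => f x ^+ n.+1) (n.+1%:R * a * f x ^+ n).
Proof.
move=> fa; rewrite (_ : (fun x => _) = f ^+ n.+1); last first.
  by apply/funext => y; rewrite exprfctE.
apply: is_derive_eq; rewrite /GRing.scale/= -mulr_natl; ring.
Qed.

Lemma is_derive_continuous f x a : is_derive x 1 f a ->
  {for x, continuous f}.
Proof.
by move=> fa; apply/differentiable_continuous/derivable1_diffP; case: fa.
Qed.

Lemma is_derive_le0_nincr (f df : R -> R) a b :
  (forall z : R, is_derive z 1 f (df z)) ->
  (forall z, a < z < b -> df z <= 0) ->
  forall x y, a <= x -> x <= y -> y <= b -> f y <= f x.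
Proof.
move=> fdf df0; apply: ler0_derive1_nincr.
- by move=> z _; case: (fdf z).
- move=> z; rewrite in_itv/= => zab.
  by rewrite derive1E (@derive_val _ _ _ _ _ _ _ (fdf z)) df0.
- apply: continuous_subspaceT => z; exact: is_derive_continuous (fdf z).
Qed.

End derivatives.

(** * The tail function *)

Section tail.
Context {R : realType}.
Variables (M K lambda : R).
Hypotheses (M_gt0 : 0 < M) (lambda_gt0 : 0 < lambda).

Definition tail_term (q : nat) (x : R) : R :=
  expR (- (lambda * (x - K)) - lambda * M * q%:R) *
  (lambda * M * q%:R + lambda * (x - K)) ^+ q / q`!%:R.

Definition tail_poly (n : nat) (x : R) : R := \sum_(q < n) tail_term q x.

Lemma is_derive_tail_exp (q : nat) (x : R) :
  is_derive x 1 (fun x => expR (- (lambda * (x - K)) - lambda * M * q%:R))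
    (- lambda * expR (- (lambda * (x - K)) - lambda * M * q%:R)).
Proof.
apply: is_derive_exp.
apply: (@is_derive_ext _
    (fun x => - lambda * x + (lambda * K - lambda * M * q%:R))) => [y|].
  by ring.
exact: is_derive_affine.
Qed.

Lemma is_derive_tail_term0 (x : R) :
  is_derive x 1 (tail_term 0) (- lambda * tail_term 0 x).
Proof.
rewrite /tail_term.
under eq_fun do rewrite expr0 mulr1.
rewrite expr0 mulr1 mulrA; apply: is_derive_mulr.
exact: is_derive_tail_exp.
Qed.

(** Moving from [x] to [x + M] is the same as raising the index inside the exponential and inside
    the base: both agree for term [q] at [x + M] and term [q.+1] at [x]. Differentiating the power
    therefore produces the delayed term, and the factorial absorbs the factor [q.+1]. *)
Lemma is_derive_tail_termS (q : nat) (x : R) :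
  is_derive x 1 (tail_term q.+1)
    (- lambda * (tail_term q.+1 x - tail_term q (x + M))).
Proof.
rewrite /tail_term.
have -> : - (lambda * (x + M - K)) - lambda * M * q%:R =
  - (lambda * (x - K)) - lambda * M * q.+1%:R :> R by rewrite -natr1; ring.
have -> : lambda * M * q%:R + lambda * (x + M - K) =
  lambda * M * q.+1%:R + lambda * (x - K) :> R by rewrite -natr1; ring.
have De := is_derive_tail_exp q.+1 x.
have Da : is_derive x 1 (fun x => lambda * M * q.+1%:R + lambda * (x - K))
    lambda.
  apply: (@is_derive_ext _
      (fun x => lambda * x + (lambda * M * q.+1%:R - lambda * K))) => [y|].
    by ring.
  exact: is_derive_affine.
have := is_derive_mulr (q.+1)`!%:R^-1 (is_derive_mul De (is_derive_expr q Da)).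
move=> /is_derive_eq; apply.
have q1 : q.+1%:R != 0 :> R by rewrite pnatr_eq0.
have q2 : q`!%:R != 0 :> R by rewrite pnatr_eq0 -lt0n fact_gt0.
rewrite factS natrM exprS; move: (_ ^+ q) => w.
by move: q1 q2; move: (q.+1%:R) (q`!%:R) => u v u0 v0; field; rewrite u0 v0.
Qed.

(** The delayed sum is one term shorter because term 0 is a pure exponential. This matches the
    geometry: if [x] lies in cell [n], then [x + M] lies in cell [n - 1]. *)
Lemma is_derive_tail_poly (n : nat) (x : R) :
  is_derive x 1 (tail_poly n.+1)
    (- lambda * (tail_poly n.+1 x - tail_poly n (x + M))).
Proof.
elim: n => [|n IHn].
  rewrite /tail_poly big_ord0 subr0.
  under eq_fun do rewrite big_ord1.
  by rewrite big_ord1; exact: is_derive_tail_term0.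
have -> : tail_poly n.+2 = fun x => tail_poly n.+1 x + tail_term n.+1 x.
  by apply/funext => y; rewrite /tail_poly big_ord_recr.
have := is_derive_add IHn (is_derive_tail_termS n x).
move=> /is_derive_eq; apply.
rewrite [tail_poly n.+1 (x + M)]/tail_poly big_ord_recr/= -/(tail_poly n _).
by ring.
Qed.

Lemma continuous_tail_poly (n : nat) : continuous (tail_poly n).
Proof.
case: n => [|n] x; last exact: is_derive_continuous (is_derive_tail_poly n x).
rewrite (_ : tail_poly 0 = cst 0); first exact: cst_continuous.
by apply/funext => y; rewrite /tail_poly big_ord0.
Qed.

(** The base of the added term vanishes at the upper end of its cell, and its exponent is
    positive. *)
Lemma tail_poly_glue (n : nat) :
  tail_poly n.+2 (K - n.+1%:R * M) = tail_poly n.+1 (K - n.+1%:R * M).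
Proof.
rewrite /tail_poly big_ord_recr/= [X in _ + X](_ : _ = 0) ?addr0//.
rewrite /tail_term [X in X ^+ _](_ : _ = 0); last by ring.
by rewrite expr0n/= mulr0 mul0r.
Qed.

(* Gronwall on one cell: there [x + M] lies in the previous cell, where the
   function is at most its value [C] at the common endpoint, so that
   [expR (lambda x) (f x - C)] is nonincreasing. *)
Lemma tail_poly_le (n : nat) (x : R) :
  K - n.+1%:R * M <= x <= K - n%:R * M ->
  tail_poly n (x + M) <= tail_poly n.+1 x.
Proof.
elim: n x => [|n IHn] x.
  move=> _; rewrite /tail_poly big_ord0 big_ord1 /tail_term.
  by rewrite !mulr_ge0// ?expR_ge0// ?invr_ge0// expr0 ler01.
have natE (m : nat) : m.+1%:R * M = m%:R * M + M by rewrite -natr1; ring.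
set a := K - n.+1%:R * M.
(* On the previous cell the induction hypothesis is the sign of the derivative, so the maximum there
   is at the lower end [a]. *)
have IH (y : R) : a <= y <= a + M -> tail_poly n.+1 y <= tail_poly n.+1 a.
  move=> /andP[ay yb].
  apply: (is_derive_le0_nincr (is_derive_tail_poly n) _ (lexx a) ay yb).
  move=> z /andP[az zb]; rewrite mulNr oppr_le0.
  apply: mulr_ge0; first exact: ltW.
  rewrite subr_ge0; apply: IHn.
  rewrite (ltW az)/= (le_trans (ltW zb))//.
  by rewrite /a natE; lra.
rewrite natE => /andP[x1 x2].
have ax : x <= a by [].
have xa : a <= x + M by rewrite /a; move: x1; lra.
set C := tail_poly n.+1 a.
have CE : C = tail_poly n.+2 a by rewrite /C /a tail_poly_glue.
have h : tail_poly n.+1 (x + M) <= C by apply: IH; rewrite xa/=; lra.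
apply: (le_trans h).
pose u := fun x : R => expR (lambda * x) * (tail_poly n.+2 x - C).
have Du (z : R) : is_derive z 1 u
    (lambda * expR (lambda * z) * (tail_poly n.+1 (z + M) - C)).
  have D := is_derive_tail_poly n.+1 z.
  have De : is_derive z 1 (fun z => expR (lambda * z))
      (lambda * expR (lambda * z)).
    apply: is_derive_exp.
    apply: (@is_derive_ext _ (fun x => lambda * x + 0)) => [y|].
      exact: addr0.
    exact: is_derive_affine.
  have := is_derive_mul De (is_derive_add D (is_derive_const (- C) z)).
  by move=> /is_derive_eq; apply; ring.
have uu : u a <= u x.
  have xM : a - M <= x by rewrite /a; lra.
  apply: (is_derive_le0_nincr Du _ xM ax (lexx a)) => z /andP[az za].
  apply: mulr_ge0_le0; first by rewrite mulr_ge0 ?expR_ge0// ltW.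
  by rewrite subr_le0; apply: IH; lra.
move: uu; rewrite /u -CE subrr mulr0 pmulr_rge0 ?expR_gt0//.
by rewrite subr_ge0.
Qed.

End tail.

(** * Integrals of functions given by a different formula on each cell *)

Section ftc_cells.
Context {R : realType}.
Notation leb := (@lebesgue_measure R).

Lemma integral_is_derive (f F : R -> R) (a b : R) : a <= b ->
  (forall x : R, is_derive x 1 F (f x)) -> continuous f ->
  (\int[leb]_(x in `[a, b[) (f x)%:E = (F b - F a)%:E)%E.
Proof.
rewrite le_eqVlt => /predU1P[-> _ _|ab dF cf].
  by rewrite set_itv_ge ?integral_set0 ?subrr// bnd_simp ltxx.
rewrite integral_itv_bndo_bndc; last first.
  by apply/measurable_EFinP/measurable_funTS; exact: continuous_measurable_fun.
rewrite (@continuous_FTC2 _ f F)//.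
- exact: continuous_subspaceT.
- split.
  + by move=> x _; case: (dF x).
  + by apply: cvg_at_right_filter; exact: is_derive_continuous (dF a).
  + by apply: cvg_at_left_filter; exact: is_derive_continuous (dF b).
- by move=> x _; rewrite derive1E; exact: derive_val.
Qed.

Lemma integral_itv_co_split (f : R -> \bar R) (a c b : R) : a <= c <= b ->
  measurable_fun setT f -> (forall x, a <= x < b -> (0 <= f x)%E) ->
  (\int[leb]_(x in `[a, b[) f x =
   \int[leb]_(x in `[a, c[) f x + \int[leb]_(x in `[c, b[) f x)%E.
Proof.
move=> /andP[ac cb] mf f0.
have E : `[a, b[%classic = `[a, c[ `|` `[c, b[ :> set R.
  apply/seteqP; split => x /=; rewrite !in_itv/=.
    by case: (ltP x c) => xc /andP[ax xb]; [left|right]; rewrite ?ax ?xb.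
  case=> /andP[h1 h2]; first by rewrite h1 (lt_le_trans h2).
  by rewrite h2 (le_trans ac).
rewrite E ge0_integral_setU//.
- exact: measurable_funTS.
- by move=> x; rewrite -E/= in_itv/=; exact: f0.
- apply/disj_setPLR => x /=; rewrite !in_itv/= => /andP[_ xc] /andP[cx _].
  by move: xc; rewrite ltNge cx.
Qed.

(* Cells are counted downwards from [K]. *)
Lemma integral_cells (K M : R) (N : nat) (w J : R -> R)
    (wn Jn : nat -> R -> R) : 0 <= M -> measurable_fun setT w ->
  (forall x, K - N%:R * M <= x < K -> 0 <= w x) ->
  (forall n (x : R), (n < N)%N -> is_derive x 1 (Jn n) (wn n x)) ->
  (forall n, (n < N)%N -> continuous (wn n)) ->
  (forall n x, (n < N)%N -> K - n.+1%:R * M <= x < K - n%:R * M ->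
    w x = wn n x) ->
  (forall n x, (n < N)%N -> K - n.+1%:R * M <= x <= K - n%:R * M ->
    J x = Jn n x) ->
  forall a b, K - N%:R * M <= a -> a <= b -> b <= K ->
  (\int[leb]_(x in `[a, b[) (w x)%:E = (J b - J a)%:E)%E.
Proof.
move=> M0 mw; elim: N => [|N IH] w0 dJ cw wE JE a b.
  rewrite mul0r subr0 => Ka ab bK.
  have -> : a = b by apply/eqP; rewrite eq_le ab (le_trans bK).
  by rewrite set_itv_ge ?integral_set0 ?subrr// bnd_simp ltxx.
have natE : N.+1%:R * M = N%:R * M + M by rewrite -natr1; ring.
have {}IH a' b' : K - N%:R * M <= a' -> a' <= b' -> b' <= K ->
    (\int[leb]_(x in `[a', b'[) (w x)%:E = (J b' - J a')%:E)%E.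
  apply: IH => //.
  - by move=> x /andP[x1 x2]; apply: w0; rewrite x2 andbT natE; lra.
  - by move=> n x nN; apply: dJ; exact: ltnW.
  - by move=> n nN; apply: cw; exact: ltnW.
  - by move=> n x nN; apply: wE; exact: ltnW.
  - by move=> n x nN; apply: JE; exact: ltnW.
set c := K - N%:R * M.
have top a' b' : K - N.+1%:R * M <= a' -> a' <= b' -> b' <= c ->
    (\int[leb]_(x in `[a', b'[) (w x)%:E = (J b' - J a')%:E)%E.
  move=> Ka ab bc.
  rewrite (JE N b')//; last by rewrite bc andbT (le_trans Ka).
  rewrite (JE N a')//; last by rewrite Ka (le_trans ab).
  have dJN (x : R) : is_derive x 1 (Jn N) (wn N x) by exact: dJ.
  rewrite -(integral_is_derive ab dJN); last exact: cw.
  apply: eq_integral => x; rewrite inE/= in_itv/= => /andP[ax xb].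
  by rewrite (wE N)// (le_trans Ka ax) (lt_le_trans xb bc).
move=> Ka ab bK.
have [ca|ac] := leP c a; first exact: IH.
have [bc|cb] := leP b c; first exact: top.
rewrite (@integral_itv_co_split _ a c b) ?(ltW ac) ?(ltW cb)//.
- rewrite top// ?(ltW ac)// IH// ?(ltW cb)//.
  by rewrite -EFinD; congr EFin; ring.
- exact/measurable_EFinP.
- move=> x /andP[ax xb]; rewrite lee_fin w0// (le_trans Ka ax)/=.
  exact: lt_le_trans bK.
Qed.

End ftc_cells.

(** * The unnormalised density and its antiderivatives *)

Section density.
Context {R : realType}.
Variables (M lambda : R) (m : nat).
Hypotheses (M_gt0 : 0 < M) (lambda_gt0 : 0 < lambda).
Let K : R := m.+2%:R * M.
Notation leb := (@lebesgue_measure R).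
Notation tail_poly := (tail_poly M K lambda).

(* On [M, K], [tail x] is the stationary mass of [x, K] divided by the mass
   of the atom at [K]. *)
Definition tail (x : R) : R :=
  \sum_(q < m.+2) expR (- (lambda * (x - K)) - lambda * M * q%:R) *
    Num.min 0 (lambda * M * q%:R + lambda * (x - K)) ^+ q / q`!%:R.

(* Level crossing: the chain leaves [0, x] at a rate proportional to the mass
   of [max x M, x + M]. *)
Definition buffer_density (x : R) : R :=
  lambda * (tail (Num.max x M) - (if x + M < K then tail (x + M) else 0)).

Let natE (n : nat) : n.+1%:R * M = n%:R * M + M.
Proof. by rewrite -natr1; ring. Qed.

(** In cell [n] the base of the power is nonnegative for [q > n], where the minimum replaces it by
    0, and nonpositive for [q <= n], where it is kept. Both ends of the cell are allowed, so a grid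
    point may be evaluated with either neighbouring formula. *)
Lemma tail_cell (n : nat) (x : R) : (n < m.+2)%N ->
  K - n.+1%:R * M <= x <= K - n%:R * M -> tail x = tail_poly n.+1 x.
Proof.
move=> nm /andP[x1 x2]; rewrite /tail /tail_poly.
rewrite -[LHS](big_mkord xpredT (fun q => expR (_ - lambda * M * q%:R) *
  Num.min 0 (lambda * M * q%:R + lambda * (x - K)) ^+ q / q`!%:R)).
rewrite -[RHS](big_mkord xpredT (fun q => tail_term M K lambda q x)).
rewrite (big_cat_nat (leq0n n.+1) nm)/=.
rewrite [X in _ + X]big_nat_cond [X in _ + X]big1 ?addr0; last first.
  move=> q /andP[/andP[nq _] _].
  rewrite min_l; first by rewrite expr0n gtn_eqF ?mulr0 ?mul0r// (leq_trans _ nq).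
  have : n.+1%:R * M <= q%:R * M by rewrite ler_pM2r// ler_nat.
  move=> h; rewrite -mulrA -mulrDr mulr_ge0 ?(ltW lambda_gt0)//.
  by rewrite mulrC; lra.
apply: eq_big_nat => q /andP[_ qn]; rewrite /tail_term min_r//.
have : q%:R * M <= n%:R * M by rewrite ler_pM2r// ler_nat.
move=> h; rewrite -mulrA -mulrDr mulr_ge0_le0 ?(ltW lambda_gt0)//.
by rewrite mulrC; lra.
Qed.

Lemma tailK : tail K = 1.
Proof.
rewrite (@tail_cell 0)//; last first.
  by rewrite mul0r subr0 lexx andbT mul1r lerBlDr lerDl ltW.
rewrite /tail_poly big_ord1 /tail_term expr0 fact0 invr1 !mulr1.
by rewrite [X in expR X](_ : _ = 0) ?expR0//=; ring.
Qed.

(** Truncated powers are continuous on the whole line, so no matching at the cell ends is needed.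
    The use is measurability of the density. *)
Lemma continuous_tail : continuous tail.
Proof.
apply: continuous_big => [|q _ x]; first exact: add_continuous.
apply: cvgMl; apply: cvgM.
  exact: is_derive_continuous (is_derive_tail_exp _ _ _ _ x).
apply: (@continuous_comp _ _ _
    (fun x => Num.min 0 (lambda * M * q%:R + lambda * (x - K)))
    (fun y : R => y ^+ q)); last exact: exprn_continuous.
apply: (@continuous_min _ _ (fun=> 0)); first exact: cst_continuous.
apply: (@is_derive_continuous _ _ _ lambda).
apply: (@is_derive_ext _
    (fun x => lambda * x + (lambda * M * q%:R - lambda * K))) => [y|].
  by ring.
exact: is_derive_affine.
Qed.

(** The density jumps at [K - M], because F drops from 1 to 0 at [K]. The strict test [x + M < K]
    assigns this point to the top cell, where the delayed sum [tail_poly 0] is empty. *)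
Lemma buffer_density_cell (n : nat) (x : R) : (n <= m)%N ->
  K - n.+1%:R * M <= x < K - n%:R * M ->
  buffer_density x = lambda * (tail_poly n.+1 x - tail_poly n (x + M)).
Proof.
move=> nm /andP[x1 x2]; rewrite /buffer_density.
have Mx : M <= x.
  apply: le_trans x1; rewrite /K natE.
  have : n.+1%:R * M <= m.+1%:R * M by rewrite ler_pM2r// ler_nat.
  by lra.
rewrite max_l// (@tail_cell n x) ?(ltW x2) ?x1//; last by rewrite ltnW.
congr (_ * (_ - _)).
case: n nm x1 x2 => [|n] nm x1 x2.
  rewrite mul1r in x1.
  rewrite ifF /tail_poly ?big_ord0//.
  by apply/negbTE; rewrite -leNgt; lra.
have n0 : 0 <= n%:R * M by rewrite mulr_ge0// ltW.
rewrite !natE in x1 x2.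
rewrite ifT; last by lra.
rewrite (@tail_cell n)//; first by rewrite ltnW// ltnW.
by rewrite natE; apply/andP; split; lra.
Qed.

Lemma buffer_density_bottom (x : R) : 0 <= x < M ->
  buffer_density x = lambda * (tail_poly m.+1 M - tail_poly m.+1 (x + M)).
Proof.
move=> /andP[x0 xM]; rewrite /buffer_density max_r ?(ltW xM)//.
have n0 : 0 <= m%:R * M by rewrite mulr_ge0// ltW.
have KE : K = m%:R * M + M + M by rewrite /K !natE.
rewrite ifT; last by lra.
by rewrite !(@tail_cell m)// natE; apply/andP; split; lra.
Qed.

Lemma tail_poly_nincr (n : nat) (x y : R) :
  K - n.+1%:R * M <= x -> x <= y -> y <= K - n%:R * M ->
  tail_poly n.+1 y <= tail_poly n.+1 x.
Proof.
move=> Kx xy yK.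
apply: (is_derive_le0_nincr (is_derive_tail_poly M K lambda n) _ Kx xy yK).
move=> z /andP[z1 z2]; rewrite mulNr oppr_le0 mulr_ge0 ?(ltW lambda_gt0)//.
by rewrite subr_ge0 tail_poly_le// !ltW.
Qed.

Lemma buffer_density_ge0 (x : R) : 0 <= x < K -> 0 <= buffer_density x.
Proof.
move=> /andP[x0 xK].
have [xM|Mx] := ltP x M.
  rewrite buffer_density_bottom ?x0// mulr_ge0 ?(ltW lambda_gt0)// subr_ge0.
  by apply: tail_poly_nincr; rewrite /K ?natE; lra.
(* Induction on [m]: raising [K] by [M] adds a cell at the top and shifts the index of every cell
   below it by one. *)
have [n nm xn] : exists2 n, (n <= m)%N & K - n.+1%:R * M <= x < K - n%:R * M.
  elim: m Mx @K xK => [|k IH] Mx K' xK.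
    by exists 0%N => //; rewrite /K' mul0r subr0 !natE mul0r add0r in xK *; lra.
  have [xk|kx] := ltP x (k.+2%:R * M - 0); last first.
    exists 0%N => //; rewrite mul0r subr0 xK andbT.
    by apply: le_trans kx; rewrite /K' !natE; lra.
  rewrite subr0 in xk; have [n nk /andP[n1 n2]] := IH Mx xk.
  exists n.+1 => //; rewrite /K' !natE in n1 n2 *.
  by apply/andP; split; lra.
rewrite (buffer_density_cell nm xn) mulr_ge0 ?(ltW lambda_gt0)// subr_ge0.
by move/andP: xn => [x1 x2]; rewrite tail_poly_le// x1 ltW.
Qed.

Lemma measurable_buffer_density : measurable_fun setT buffer_density.
Proof.
have mt : measurable_fun setT tail.
  exact: continuous_measurable_fun continuous_tail.
apply: measurable_funM => //; apply: measurable_funB.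
  by apply: measurableT_comp => //; exact: measurable_maxr.
apply: measurable_fun_ifT => //.
  by apply: measurable_fun_ltr => //; exact: measurable_funD.
by apply: measurableT_comp => //; exact: measurable_funD.
Qed.

Let KmM : K - m.+1%:R * M = M.
Proof. by rewrite /K natE; ring. Qed.

Let cellM (x : R) : K - m.+1%:R * M <= x < K -> 0 <= x < K.
Proof. by rewrite KmM => /andP[/(le_trans (ltW M_gt0)) -> ->]. Qed.

Lemma integral_density (a b : R) : M <= a -> a <= b -> b <= K ->
  (\int[leb]_(x in `[a, b[) (buffer_density x)%:E = (tail a - tail b)%:E)%E.
Proof.
move=> Ma ab bK.
pose wn n x := lambda * (tail_poly n.+1 x - tail_poly n (x + M)).
have dJ n (x : R) : (n < m.+1)%N ->
    is_derive x 1 (fun x => - tail_poly n.+1 x) (wn n x).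
  move=> _; have := is_derive_mull (-1) (is_derive_tail_poly M K lambda n x).
  move=> h; apply: (@is_derive_ext _ _ _ _ _ _ (is_derive_eq h _)) => [y|].
    by rewrite mulN1r.
  by rewrite /wn; ring.
rewrite (integral_cells (K := K) (J := fun x => - tail x) (ltW M_gt0) _ _ dJ)//.
- by rewrite opprK addrC.
- exact: measurable_buffer_density.
- by move=> x /cellM; exact: buffer_density_ge0.
- move=> n _ x; apply: cvgMr; apply: cvgB; first exact: continuous_tail_poly.
  apply: continuous_comp; last exact: continuous_tail_poly.
  by apply: cvgD => //; exact: cvg_cst.
- by move=> n x nm; exact: buffer_density_cell.
- by move=> n x nm xn; rewrite (@tail_cell n)// ltnW.
- by rewrite KmM.
Qed.

Let derive_expl (x : R) :
  is_derive x 1 (fun x => expR (lambda * x)) (lambda * expR (lambda * x)).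
Proof.
apply: is_derive_exp.
apply: (@is_derive_ext _ (fun x => lambda * x + 0)) => [y|]; first exact: addr0.
exact: is_derive_affine.
Qed.

Let cont_expl : continuous (fun x : R => expR (lambda * x)).
Proof. by move=> x; exact: is_derive_continuous (derive_expl x). Qed.

Let cont_tailM n : continuous (fun x => tail_poly n (x + M)).
Proof.
move=> x; apply: continuous_comp; last exact: continuous_tail_poly.
by apply: cvgD => //; exact: cvg_cst.
Qed.

(** The terms in [tail (x - M)] cancel in the derivative. In the lowest cell of [M, K] the point
    [x - M] is below [M], which is why [tail] has [m.+2] terms and not [m.+1]. *)
Lemma integral_density_exp (a b : R) : M <= a -> a <= b -> b <= K ->
  (\int[leb]_(x in `[a, b[) (buffer_density x * expR (lambda * x))%:E =
   (expR (lambda * b) * (tail (b - M) - tail b) -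
    expR (lambda * a) * (tail (a - M) - tail a))%:E)%E.
Proof.
move=> Ma ab bK.
pose wn n x := lambda * (tail_poly n.+1 x - tail_poly n (x + M)) *
  expR (lambda * x).
have dJ n (x : R) : (n < m.+1)%N -> is_derive x 1
    (fun x => expR (lambda * x) * (tail_poly n.+2 (x - M) - tail_poly n.+1 x))
    (wn n x).
  move=> _.
  have D1 : is_derive x 1 (fun x => tail_poly n.+2 (x - M))
      (- lambda * (tail_poly n.+2 (x - M) - tail_poly n.+1 x)).
    have h := is_derive_tail_poly M K lambda n.+1 (x - M).
    have g : is_derive x 1 (fun x => x - M) 1.
      apply: (@is_derive_ext _ (fun x => 1 * x - M)) => [y|].
        by rewrite mul1r.
      exact: is_derive_affine.
    have := @is_derive1_comp _ (tail_poly n.+2) (fun x => x - M) x _ _ h g.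
    by rewrite subrK mulr1.
  have D2 := is_derive_mull (-1) (is_derive_tail_poly M K lambda n x).
  have := is_derive_mul (derive_expl x) (is_derive_add D1 D2).
  move=> h; apply: (@is_derive_ext _ _ _ _ _ _ (is_derive_eq h _)) => [y|].
    by rewrite mulN1r.
  by rewrite /wn; ring.
rewrite (integral_cells (K := K)
  (J := fun x => expR (lambda * x) * (tail (x - M) - tail x))
  (ltW M_gt0) _ _ dJ)//.
- apply: measurable_funM; first exact: measurable_buffer_density.
  exact: continuous_measurable_fun cont_expl.
- by move=> x /cellM x0; rewrite mulr_ge0 ?expR_ge0// buffer_density_ge0.
- move=> n _ x; apply: cvgM; last exact: cont_expl.
  apply: cvgMr; apply: cvgB; first exact: continuous_tail_poly.
  exact: cont_tailM.
- by move=> n x nm xn; rewrite (buffer_density_cell _ xn).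
- move=> n x nm xn; rewrite (@tail_cell n x)//; last by rewrite ltnW.
  rewrite (@tail_cell n.+1)//.
  by move: xn; rewrite !natE => /andP[x1 x2]; apply/andP; split; lra.
- by rewrite KmM.
Qed.

(** Same cancellation, now of the terms in [tail x]: below [M] the density contains the constant
    [tail M] in place of [tail x]. *)
Lemma integral_density_exp_bottom (a b : R) : 0 <= a -> a <= b -> b <= M ->
  (\int[leb]_(x in `[a, b[) (buffer_density x * expR (lambda * x))%:E =
   (expR (lambda * b) * (tail M - tail b) -
    expR (lambda * a) * (tail M - tail a))%:E)%E.
Proof.
move=> a0 ab bM.
have tailE (x : R) : 0 <= x <= M -> tail x = tail_poly m.+2 x.
  by move=> x0; rewrite (@tail_cell m.+1)// /K natE; lra.
rewrite (tailE b); last by rewrite bM andbT (le_trans a0).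
rewrite (tailE a); last by rewrite a0 (le_trans ab).
have -> : tail M = tail_poly m.+1 M.
  by rewrite (@tail_cell m)// KmM lexx/= /K !natE; lra.
pose w x := lambda * (tail_poly m.+1 M - tail_poly m.+1 (x + M)) *
  expR (lambda * x).
have dJ (x : R) : is_derive x 1
    (fun x => expR (lambda * x) * (tail_poly m.+1 M - tail_poly m.+2 x)) (w x).
  have D2 := is_derive_mull (-1) (is_derive_tail_poly M K lambda m.+1 x).
  have D := is_derive_add (is_derive_const (tail_poly m.+1 M) x) D2.
  have h := is_derive_mul (derive_expl x) D.
  apply: (@is_derive_ext _ _ _ _ _ _ (is_derive_eq h _)) => [y|].
    by rewrite mulN1r.
  by rewrite /w; ring.
rewrite -(integral_is_derive ab dJ).
- apply: eq_integral => x; rewrite inE/= in_itv/= => /andP[ax xb].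
  by rewrite buffer_density_bottom// (le_trans a0 ax) (lt_le_trans xb).
- move=> x; apply: cvgM; last exact: cont_expl.
  apply: cvgMr; apply: cvgB; first exact: cvg_cst.
  exact: cont_tailM.
Qed.

End density.

(** * Measures with a density and an atom *)

Section density_measure.
Local Open Scope ereal_scope.
Context {R : realType}.
Notation leb := (@lebesgue_measure R).
Variables (f : R -> R) (f0 : forall x, (0 <= f x)%R).
Hypothesis mf : measurable_fun setT f.

(* The unused proofs let unification find the measure structure. *)
Definition density_measure of measurable_fun setT f & (forall x, (0 <= f x)%R)
  := fun A : set R => \int[leb]_(x in A) (f x)%:E.

Local Notation nu := (density_measure mf f0).

Let nu0 : nu set0 = 0.
Proof. by rewrite /density_measure integral_set0. Qed.

Let nu_ge0 A : 0 <= nu A.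
Proof. by apply: integral_ge0 => x _; rewrite lee_fin. Qed.

Let nu_sigma_additive : semi_sigma_additive nu.
Proof.
move=> /= F mF tF mUF; rewrite /density_measure; apply: cvg_toP.
  apply: ereal_nondecreasing_is_cvgn => m n mn.
  apply: lee_sum_nneg_natr => // k _ _; apply: integral_ge0 => /= x Fkx.
  by rewrite lee_fin.
rewrite ge0_integral_bigcup//=.
- exact/measurable_funTS/measurable_EFinP.
- by move=> x _; rewrite lee_fin.
Qed.

HB.instance Definition _ := isMeasure.Build _ _ _ nu nu0 nu_ge0
  nu_sigma_additive.

Import HBNNSimple.

(** Standard extension: linearity over indicators for simple functions increasing to [k], then
    monotone convergence on both sides. *)
Lemma integral_density_measure (k : R -> \bar R) :
  measurable_fun setT k -> (forall x, 0 <= k x) ->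
  \int[nu]_x k x = \int[leb]_x (k x * (f x)%:E).
Proof.
move=> mk k0; pose k_ := nnsfun_approx measurableT mk.
have cvgk x : (k_ n x)%:E @[n --> \oo] --> k x.
  by apply: cvg_nnsfun_approx.
have mk_ n : measurable_fun setT (fun x => (k_ n x)%:E).
  exact/measurable_EFinP/measurable_funP.
have mkf n : measurable_fun [set: R] (fun x : R => (k_ n x)%:E * (f x)%:E).
  by apply: emeasurable_funM => //; exact/measurable_EFinP.
have ndk x : {homo (fun n => (k_ n x)%:E) : m n / (m <= n)%N >-> m <= n}.
  by move=> m n mn; rewrite lee_fin; exact/lefP/nd_nnsfun_approx.
transitivity (limn (fun n => \int[nu]_x (k_ n x)%:E)).
  rewrite -monotone_convergence//.
  - by apply: eq_integral => x _; apply/esym/cvg_lim => //.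
  - by move=> n x _; rewrite lee_fin.
transitivity (limn (fun n => \int[leb]_x ((k_ n x)%:E * (f x)%:E))); last first.
  rewrite -monotone_convergence//.
  - apply: eq_integral => x _; apply/cvg_lim => //.
    by apply: cvgeZr => //; exact: cvgk.
  - by move=> n x _; rewrite -EFinM lee_fin mulr_ge0.
  - by move=> x _ m n mn; rewrite lee_wpmul2r ?lee_fin//; exact: ndk.
congr (limn _); apply/funext => n.
have mi r : measurable_fun [set: R] (fun x => (\1_(k_ n @^-1` [set r]) x : R)).
  by apply: measurable_indic; exact: measurable_sfunP.
have mrf r : measurable_fun [set: R]
    (fun x : R => (r * \1_(k_ n @^-1` [set r]) x)%:E * (f x)%:E).
  apply: emeasurable_funM; last exact/measurable_EFinP.
  exact/measurable_EFinP/measurable_funM.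
have mif r : measurable_fun [set: R]
    (fun x : R => (\1_(k_ n @^-1` [set r]) x)%:E * (f x)%:E).
  apply: emeasurable_funM; last exact/measurable_EFinP.
  exact/measurable_EFinP.
transitivity (\sum_(r \in range (k_ n))
    \int[nu]_x (r * \1_(k_ n @^-1` [set r]) x)%:E).
  under eq_integral do rewrite fimfunE -fsumEFin//.
  rewrite ge0_integral_fsum//.
  - by move=> y; exact/measurable_EFinP/measurable_funM.
  - by move=> y x _; rewrite nnfun_muleindic_ge0.
transitivity (\int[leb]_x \sum_(r \in range (k_ n))
    ((r * \1_(k_ n @^-1` [set r]) x)%:E * (f x)%:E)); last first.
  apply: eq_integral => x _; rewrite [in RHS]fimfunE -fsumEFin//.
  by rewrite ge0_mule_fsuml// => r; exact: nnfun_muleindic_ge0.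
rewrite ge0_integral_fsum//; last first.
  by move=> r x _; rewrite mule_ge0 ?nnfun_muleindic_ge0// lee_fin.
apply: eq_fsbigr => r /[!inE] -[y _ yr].
have r0 : (0 <= r)%R by rewrite -yr.
rewrite integralZl_indic_nnsfun// integral_indic//= setIT.
under [RHS]eq_integral do rewrite EFinM -muleA.
rewrite ge0_integralZl//; last by move=> x _; rewrite mule_ge0// lee_fin.
  congr (_ * _); rewrite /density_measure [LHS]integral_mkcond.
  apply: eq_integral => x _; rewrite patchE indicE.
  by case: ifPn => _; rewrite ?mul1e ?mul0e.
exact: mif.
Qed.

End density_measure.

Section atom.
Context {R : realType}.
Notation leb := (@lebesgue_measure R).

(** The rays are stable under intersection, generate the Borel sets and exhaust the line. Invariance
    thus becomes an identity in one real parameter. *)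
Lemma probability_eq_rays (mu nu : probability R R) :
  (forall x : R, mu `]x, +oo[%classic = nu `]x, +oo[%classic) ->
  forall A, measurable A -> mu A = nu A.
Proof.
move=> munu A mA.
apply: (measure_unique (@RGenOInfty.G R)
  (fun n : nat => `](- n%:R)%R, +oo[%classic)) => //.
- exact: RGenOInfty.measurableE.
- move=> _ _ [x ->] [y ->]; exists (Num.max x y).
  apply/seteqP; split => z /=; rewrite !in_itv/= !andbT gt_max.
    by move=> [-> ->].
  by move=> /andP[].
- by move=> n; exists (- n%:R).
- apply/seteqP; split => // x _; exists (Num.bound `|x|) => //=.
  rewrite in_itv/= andbT ltrNl; apply: le_lt_trans (archi_boundP _) => //.
  by rewrite ler_normr lexx orbT.
- by move=> _ [x ->]; exact: munu.
- by move=> n; rewrite (le_lt_trans (probability_le1 _ _))// ltry.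
Qed.

Variables (K : R) (g : R -> R) (p : {nonneg R}).
Hypotheses (g0 : forall x, 0 <= g x) (mg : measurable_fun setT g).

Definition atomic_measure :=
  measure_add (density_measure mg g0) (mscale p \d_K).

HB.instance Definition _ := Measure.on atomic_measure.

Lemma integral_atomic_measure (k : R -> \bar R) :
  measurable_fun setT k -> (forall x, 0 <= k x)%E ->
  (\int[atomic_measure]_x k x =
   \int[leb]_x (k x * (g x)%:E) + p%:num%:E * k K)%E.
Proof.
move=> mk k0; rewrite ge0_integral_measure_add// integral_density_measure//.
by rewrite ge0_integral_mscale// integral_dirac// diracT mul1e.
Qed.

End atom.

(** * One step of the chain *)

Section exponential_law.
Context {R : realType}.
Variables (lambda : R) (lambda_gt0 : 0 < lambda).
Notation leb := (@lebesgue_measure R).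

Let pdf_ge0 (x : R) : 0 <= exponential_pdf lambda x.
Proof. by apply: exponential_pdf_ge0; exact: ltW. Qed.

(* [exponential_prob lambda] is a measure only through a proof of
   [0 < lambda], which unification cannot recover from the term. *)
Definition exponential_law :=
  density_measure (measurable_exponential_pdf lambda) pdf_ge0.

HB.instance Definition _ := Measure.on exponential_law.

Let exponential_law_setT : exponential_law setT = 1%E.
Proof. exact: integral_exponential_pdf. Qed.

HB.instance Definition _ := @Measure_isProbability.Build _ _ R
  exponential_law exponential_law_setT.

Lemma exponential_lawE (A : set R) :
  exponential_law A = exponential_prob lambda A.
Proof. by []. Qed.

Lemma exponential_prob_itvy (a : R) :
  exponential_prob lambda `]a, +oo[%classic =
  (expR (- (lambda * Num.max 0 a)))%:E.
Proof.
have mpdf : measurable_fun [set: R] (EFin \o exponential_pdf lambda).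
  by apply/measurable_EFinP; exact: measurable_exponential_pdf.
have [a0|a0] := leP 0 a.
  rewrite /exponential_prob integral_itv_obnd_cbnd; last exact: measurable_funTS.
  rewrite (@ge0_continuous_FTC2y _ _
    (fun x => - expR (- lambda * x)) _ 0)//.
  - by rewrite sub0e -EFinN opprK mulNr.
  - apply: (@continuous_subspaceW R^o _ _ [set` `[0, +oo[%R]); last first.
      exact: within_continuous_exponential_pdf.
    by move=> x /=; rewrite !in_itv/= !andbT; exact: le_trans.
  - rewrite -oppr0; apply: cvgN.
    rewrite (_ : (fun x => expR (- lambda * x)) =
                 (fun z => expR (- z)) \o (fun z => lambda * z)); last first.
      by apply: eq_fun => x; rewrite mulNr.
    apply: (@cvg_comp _ _ _ _ _ _ (pinfty_nbhs R)); last exact: cvgr_expR.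
    exact: gt0_cvgMry.
  - apply: cvgN; apply/cvg_at_right_filter.
    apply: (@is_derive_continuous _ (fun x => expR (- lambda * x)) a
      (- lambda * expR (- lambda * a))).
    apply: is_derive_exp.
    apply: (@is_derive_ext _ (fun x => - lambda * x + 0)) => [y|].
      exact: addr0.
    exact: is_derive_affine.
  - move=> x; rewrite in_itv/= andbT => ax; apply: derive1_exponential_pdf.
    by rewrite in_itv/= andbT (le_lt_trans a0).
(* For [a < 0] the density vanishes outside the ray, which therefore carries the whole mass. *)
rewrite mulr0 oppr0 expR0 -[RHS](integral_exponential_pdf lambda_gt0).
rewrite /exponential_prob integral_mkcond.
apply: eq_integral => x _; rewrite patchE mem_setE in_itv/= andbT.
by case: ltP => // xa; rewrite lt0_exponential_pdf// (le_lt_trans xa).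
Qed.

End exponential_law.

Lemma integral_probability_cst (R : realType) (mu : probability R R) (c : R) :
  (\int[mu]_x c%:E = c%:E)%E.
Proof.
have muT : mu setT = 1%E by exact: probability_setT.
by rewrite integral_cst// [X in (_ * X)%E]muT mule1.
Qed.

(** * Contraction of one step in total variation *)

Section doeblin.
Context {R : realType}.
Variables (M K lambda : R).
Hypotheses (K_gt0 : 0 < K) (lambda_gt0 : 0 < lambda).
Local Notation exp_law := (exponential_law lambda_gt0).
Local Notation step := (storage_step M K).
Local Notation eps := (expR (- (lambda * K))).

Lemma measurable_step :
  measurable_fun setT (fun z : R * R => step z.1 z.2).
Proof.
have mlt : measurable_fun setT (fun z : R * R => (M < z.1)%R%:R : R).
  rewrite (_ : (fun _ => _) = fun z : R * R => if M < z.1 then 1 else 0).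
    by apply: measurable_fun_ifT => //; exact: measurable_fun_ltr.
  by apply/funext => z; case: ifP.
rewrite /storage_step; apply: measurable_minr => //.
apply: measurable_funD => //; apply: measurable_funB => //.
exact: measurable_funM.
Qed.

Lemma step_range (b x : R) : 0 <= b <= K -> 0 <= x -> 0 <= step b x <= K.
Proof.
move=> /andP[b0 bK] x0; rewrite /storage_step ge_min lexx orbT andbT.
rewrite le_min (ltW K_gt0) andbT addr_ge0//.
by case: ltP => [/ltW Mb|_]; rewrite ?mulr1 ?mulr0 subr_ge0.
Qed.

(** As the measure of a section, the kernel integrates over [b] to a product measure, which gives
    access to Tonelli. *)
Lemma storage_kernelE (b : R) (A : set R) :
  storage_kernel M K lambda b A =
  exp_law (xsection ((fun z : R * R => step z.1 z.2) @^-1` A) b).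
Proof.
rewrite /storage_kernel -exponential_lawE; congr (exp_law _).
by apply/seteqP; split => x; rewrite /xsection/= inE.
Qed.

(** A relation between laws, so that stationarity ([evolves mu mu]) and the passage from the law of
    [B n] to that of [B n.+1] are both instances. *)
Definition evolves (mu mu' : probability R R) :=
  forall A : set R, measurable A ->
  (\int[mu]_b storage_kernel M K lambda b A)%E = mu' A.

Lemma evolves_product (mu mu' : probability R R) (A : set R) :
  measurable A -> evolves mu mu' ->
  mu' A = (mu \x exp_law)%E ((fun z : R * R => step z.1 z.2) @^-1` A).
Proof.
move=> mA <-//; rewrite /product_measure1.
by apply: eq_integral => b _; exact: storage_kernelE.
Qed.

Lemma measurable_step2 (k : R -> R) : measurable_fun setT k ->
  measurable_fun setT (fun z : R * R => k (step z.1 z.2)).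
Proof. by move=> mk; exact: measurableT_comp mk measurable_step. Qed.

Lemma integral_evolves (mu mu' : probability R R) (k : R -> R) :
  evolves mu mu' -> measurable_fun setT k -> (forall x, 0 <= k x) ->
  (\int[mu']_x (k x)%:E = \int[mu]_b \int[exp_law]_x (k (step b x))%:E)%E.
Proof.
move=> ev mk k0.
pose phi := fun z : R * R => step z.1 z.2.
transitivity (\int[pushforward (mu \x exp_law)%E phi]_x (k x)%:E)%E.
  apply: eq_measure_integral => [|? A mA _]; first exact: measurable_step.
  exact: evolves_product mA ev.
rewrite ge0_integral_pushforward//; last 3 first.
- exact: measurable_step.
- exact/measurable_EFinP.
- by move=> x _; rewrite lee_fin.
rewrite preimage_setT fubini_tonelli1//.
- by apply/measurable_EFinP; exact: measurable_step2.
- by move=> z; rewrite lee_fin.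
Qed.

(* Whatever the content in [0, K], an inflow above [K] fills the buffer; [r] is
   the conditional expectation given the complementary event. *)
Lemma doeblin_split (k : R -> R) : measurable_fun setT k ->
  (forall x, 0 <= k x <= 1) ->
  exists r : R -> R, [/\ measurable_fun setT r, forall b, 0 <= r b <= 1 &
    forall b, 0 <= b <= K -> (\int[exp_law]_x (k (step b x))%:E =
      ((1 - eps) * r b + eps * k K)%:E)%E].
Proof.
move=> mk k01.
have k0 x : 0 <= k x by have /andP[] := k01 x.
have k1 x : k x <= 1 by have /andP[] := k01 x.
have eps1 : eps < 1 by rewrite expR_lt1 oppr_lt0 mulr_gt0.
pose h (z : R * R) : R := if z.2 <= K then k (step z.1 z.2) else 0.
have h0 z : 0 <= h z by rewrite /h; case: ifP.
have mh : measurable_fun setT h.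
  apply: measurable_fun_ifT => //; last exact: measurable_step2.
  exact: measurable_fun_ler.
have mh1 b : measurable_fun setT (fun x => h (b, x)).
  exact: measurableT_comp mh _.
pose H b := (\int[exp_law]_x (h (b, x))%:E)%E.
have H0 b : (0 <= H b)%E by apply: integral_ge0 => x _; rewrite lee_fin.
have tailKE : exp_law `]K, +oo[%classic = eps%:E.
  by rewrite exponential_lawE exponential_prob_itvy// max_r// ltW.
have headKE : exp_law `]-oo, K]%classic = (1 - eps)%:E.
  rewrite -[X in exp_law X]setCK setCitvl probability_setC//=.
  by rewrite tailKE.
have H1 b : (H b <= (1 - eps)%:E)%E.
  rewrite -headKE -[X in exp_law X]setIT -integral_indic//.
  apply: ge0_le_integral => //.
  - by move=> x _; rewrite lee_fin.
  - exact/measurable_EFinP.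
  - by apply/measurable_EFinP; exact: measurable_indic.
  - move=> x _; rewrite lee_fin /h/= indicE mem_setE in_itv/=.
    by case: ifP => //; rewrite k1.
have Hfin b : H b \is a fin_num.
  by rewrite ge0_fin_numE// (le_lt_trans (H1 b))// ltry.
(* [H b] collects the inflows up to [K], whose total mass is [1 - eps]; dividing by it brings the
   values into [0, 1]. *)
exists (fun b => fine (H b) / (1 - eps)); split.
- apply: measurable_funM => //; apply: measurableT_comp => //.
  apply: (@measurable_fun_fubini_tonelli_F _ _ _ _ _ _ (EFin \o h)).
    exact/measurable_EFinP.
  by move=> z; rewrite lee_fin.
- move=> b; rewrite divr_ge0 ?fine_ge0// ?subr_ge0 ?(ltW eps1)//=.
  rewrite ler_pdivrMr ?subr_gt0// mul1r.
  by rewrite -lee_fin fineK.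
move=> b b0K.
rewrite mulrC divfK ?gt_eqF ?subr_gt0// EFinD fineK// mulrC EFinM -tailKE.
rewrite -[X in exp_law X]setIT -integral_indic// -ge0_integralZl//; last 2 first.
- by apply/measurable_EFinP; exact: measurable_indic.
- by rewrite lee_fin.
rewrite -ge0_integralD//; last 4 first.
- by move=> x _; rewrite lee_fin.
- exact/measurable_EFinP.
- by move=> x _; rewrite mule_ge0 ?lee_fin.
- apply: emeasurable_funM => //.
  by apply/measurable_EFinP; exact: measurable_indic.
apply: eq_integral => x _.
rewrite -EFinM -EFinD /h/= indicE mem_setE in_itv/= andbT.
case: leP => [_|Kx]; first by rewrite mulr0 addr0.
rewrite mulr1 add0r; congr (k _)%:E.
rewrite /storage_step min_r// (le_trans (ltW Kx))// lerDr.
case/andP: b0K => b0 _.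
by case: ltP => [/ltW Mb|_]; rewrite ?mulr1 ?mulr0 subr_ge0.
Qed.

(** Test functions with values in [0, 1] replace sets because one step backwards turns an indicator
    into the function [r] of [doeblin_split], which need not be an indicator. The bound is
    one-sided; exchanging the laws gives the other side. *)
Definition tv_close (mu nu : probability R R) (c : R) :=
  forall k : R -> R, measurable_fun setT k -> (forall x, 0 <= k x <= 1) ->
  (\int[mu]_x (k x)%:E <= \int[nu]_x (k x)%:E + c%:E)%E.

(** The law [mu] enters only through the term with factor [1 - eps]; the other term is common to all
    laws on [0, K] and disappears when two of them are compared. The split is known on [0, K] only,
    hence an almost everywhere argument. *)
Lemma integral_doeblin (mu mu' : probability R R) (k r : R -> R) :
  mu `[0, K]%classic = 1%E -> evolves mu mu' ->
  measurable_fun setT k -> (forall x, 0 <= k x <= 1) ->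
  measurable_fun setT r -> (forall b, 0 <= r b <= 1) ->
  (forall b, 0 <= b <= K -> (\int[exp_law]_x (k (step b x))%:E =
    ((1 - eps) * r b + eps * k K)%:E)%E) ->
  (\int[mu']_x (k x)%:E =
    (1 - eps)%:E * \int[mu]_b (r b)%:E + (eps * k K)%:E)%E.
Proof.
move=> mu1 ev mk k01 mr r01 kE.
have k0 x : 0 <= k x by have /andP[] := k01 x.
have r0 x : 0 <= r x by have /andP[] := r01 x.
have eps1 : eps < 1 by rewrite expR_lt1 oppr_lt0 mulr_gt0.
have muC : mu (~` `[0, K]%classic) = 0%E.
  by rewrite probability_setC// mu1 subee.
rewrite (integral_evolves ev mk k0).
transitivity (\int[mu]_b ((1 - eps) * r b + eps * k K)%:E)%E.
  apply: ge0_ae_eq_integral => //.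
  - apply: (@measurable_fun_fubini_tonelli_F _ _ _ _ _ _
      (fun z : R * R => (k (step z.1 z.2))%:E)).
      by apply/measurable_EFinP; exact: measurable_step2.
    by move=> z; rewrite lee_fin.
  - apply/measurable_EFinP; apply: measurable_funD => //.
    exact: measurable_funM.
  - by move=> b _; apply: integral_ge0 => x _; rewrite lee_fin.
  - move=> b _; rewrite lee_fin addr_ge0 ?mulr_ge0 ?expR_ge0//.
    by rewrite subr_ge0 ltW.
  exists (~` `[0, K]%classic); split.
  - exact: measurableC.
  - exact: muC.
  - move=> b /= nb; apply: contra_not nb => b0K _.
    by apply: kE; move: b0K; rewrite /= in_itv.
under eq_integral do rewrite EFinD EFinM.
have rE0 b : (0 <= (r b)%:E)%E by rewrite lee_fin.
have eE0 : (0 <= (1 - eps)%:E)%E by rewrite lee_fin subr_ge0 ltW.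
have kE0 : (0 <= (eps * k K)%:E)%E by rewrite lee_fin mulr_ge0// expR_ge0.
have er0 b : (0 <= (1 - eps)%:E * (r b)%:E)%E by rewrite mule_ge0.
have mrE : measurable_fun setT (fun b => (r b)%:E) by exact/measurable_EFinP.
have mer : measurable_fun setT (fun b => (1 - eps)%:E * (r b)%:E)%E.
  exact: emeasurable_funM.
rewrite ge0_integralD// ge0_integralZl//.
by rewrite integral_probability_cst.
Qed.

Lemma evolves_range (mu mu' : probability R R) :
  mu `[0, K]%classic = 1%E -> evolves mu mu' -> mu' `[0, K]%classic = 1%E.
Proof.
move=> mu1 ev; pose S : set R := `[0, K]%classic.
have SK : \1_S K = 1 :> R.
  by rewrite indicE mem_setE in_itv/= lexx (ltW K_gt0).
(* The split of the indicator of [0, K] with [r] constantly 1: both sides equal 1, since the inflow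
   is almost surely positive. *)
have kE (b : R) : 0 <= b <= K ->
    (\int[exp_law]_x (\1_S (step b x))%:E =
     ((1 - eps) * 1 + eps * \1_S K)%:E)%E.
  move=> b0K; rewrite SK !mulr1 subrK.
  have mA : measurable (step b @^-1` S).
    rewrite -[X in measurable X]setTI.
    have mb : measurable_fun setT (step b).
      exact: measurableT_comp measurable_step (pair1_measurable b).
    by apply: mb => //; exact: measurable_itv.
  have -> : (\int[exp_law]_x (\1_S (step b x))%:E =
      exp_law (step b @^-1` S))%E.
    rewrite -[X in exp_law X]setIT -integral_indic//.
  apply/eqP; rewrite eq_le probability_le1//=.
  have <- : exp_law `]0, +oo[%classic = 1%E.
    rewrite exponential_lawE exponential_prob_itvy// max_l//.
    by rewrite mulr0 oppr0 expR0.
  apply: le_measure; rewrite ?inE//.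
  by move=> x /=; rewrite !in_itv/= andbT => /ltW; exact: step_range.
have mS : measurable S by exact: measurable_itv.
have <- : (\int[mu']_x (\1_S x)%:E = mu' S)%E by rewrite integral_indic// setIT.
rewrite (integral_doeblin mu1 ev _ _ _ _ kE)//.
- by rewrite SK mulr1 integral_probability_cst mule1 -EFinD subrK.
- by move=> x; rewrite indicE; case: (_ \in _); rewrite ?lexx ?ler01.
- by move=> _; rewrite lexx ler01.
Qed.

Lemma tv_close_evolves (mu nu mu' nu' : probability R R) (c : R) : 0 <= c ->
  mu `[0, K]%classic = 1%E -> nu `[0, K]%classic = 1%E ->
  evolves mu mu' -> evolves nu nu' ->
  tv_close mu nu c -> tv_close mu' nu' ((1 - eps) * c).
Proof.
move=> c0 mu1 nu1 emu enu munu k mk k01.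
have [r [mr r01 rE]] := doeblin_split mk k01.
rewrite (integral_doeblin mu1 emu mk k01 mr r01 rE).
rewrite (integral_doeblin nu1 enu mk k01 mr r01 rE).
have eps1 : 0 <= 1 - eps by rewrite subr_ge0 ltW// expR_lt1 oppr_lt0 mulr_gt0.
rewrite addeAC; apply: leeD => //.
rewrite EFinM -ge0_muleDr//; last first.
  by apply: integral_ge0 => x _; rewrite lee_fin; case/andP: (r01 x).
by apply: lee_wpmul2l; [rewrite lee_fin | exact: munu].
Qed.

Lemma tv_close1 (mu nu : probability R R) : tv_close mu nu 1.
Proof.
move=> k mk k01.
apply: (@le_trans _ _ (\int[mu]_x 1%:E)%E).
  apply: ge0_le_integral => //.
  - by move=> x _; rewrite lee_fin; case/andP: (k01 x).
  - exact/measurable_EFinP.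
  - by move=> x _; rewrite lee_fin; case/andP: (k01 x).
rewrite integral_probability_cst leeDr//.
by apply: integral_ge0 => x _; rewrite lee_fin; case/andP: (k01 x).
Qed.

Lemma tv_close_set (mu nu : probability R R) (c : R) (A : set R) :
  measurable A -> tv_close mu nu c -> (mu A <= nu A + c%:E)%E.
Proof.
move=> mA munu.
have /munu : measurable_fun setT (\1_A : R -> R) by exact: measurable_indic.
rewrite !integral_indic// !setIT; apply => x.
by rewrite indicE; case: (_ \in _); rewrite ?lexx ?ler01.
Qed.

End doeblin.

(** * From the recursion for [B] to the evolution of its law *)

Section chain.
Context {R : realType}.
Variables (M K lambda : R).
Hypothesis lambda_gt0 : 0 < lambda.
Local Notation exp_law := (exponential_law lambda_gt0).
Context d (T : measurableType d) (P : probability T R).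
Variables (X B : nat -> {RV P >-> R}).
Hypothesis X_exponential : forall (i : nat) (A : set R), measurable A ->
  distribution P (X i) A = exponential_prob lambda A.
Hypothesis independence : mutually_independent (cons_family (B 0%N) X).
Hypothesis B_rec : forall (i : nat) (t : T),
  B i.+1 t = storage_step M K (B i t) (X i t).

Let cyl (s : seq nat) (A : nat -> set R) : set T :=
  \bigcap_(i in [set` s]) (X i @^-1` A i).

Let measurable_pre (Z : {RV P >-> R}) (A : set R) :
  measurable A -> measurable (Z @^-1` A).
Proof.
by move=> mA; rewrite -[X in measurable X]setTI; exact: measurable_funP.
Qed.

Let cyl_cons i s A : cyl (i :: s) A = X i @^-1` A i `&` cyl s A.
Proof.
apply/seteqP; split => t.
  move=> h; split; first by apply: h; rewrite /= mem_head.
  by move=> j /= js; apply: h; rewrite /= inE js orbT.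
by move=> [hi hs] j /=; rewrite inE => /predU1P[->//|]; exact: hs.
Qed.

Let measurable_cyl s A : (forall i, measurable (A i)) -> measurable (cyl s A).
Proof.
move=> mA; elim: s => [|i s IH].
  by rewrite (_ : cyl _ _ = setT)//; apply/seteqP; split.
by rewrite cyl_cons; apply: measurableI => //; exact: measurable_pre.
Qed.

(** The invariant behind the Markov property: the content at time [n] is independent of the inflows
    that it has not yet received. *)
Let indep_future (n : nat) :=
  forall (A0 : set R) (s : seq nat) (A : nat -> set R),
  measurable A0 -> uniq s -> (forall i, i \in s -> (n <= i)%N) ->
  (forall i, measurable (A i)) ->
  P (B n @^-1` A0 `&` cyl s A) =
  (P (B n @^-1` A0) * \prod_(i <- s) P (X i @^-1` A i))%E.

Let indep_future0 : indep_future 0.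
Proof.
move=> A0 s A mA0 us _ mA.
have := independence (s := 0%N :: map S s)
  (A := fun i => if i is j.+1 then A j else A0).
rewrite big_cons big_map /= => <-; last 2 first.
- by rewrite map_inj_uniq ?us ?andbT; [apply/mapP => -[]|exact: succn_inj].
- by case.
congr (P _); apply/seteqP; split => t.
  move=> [h0 hs] [|j] //=; rewrite inE/= => /mapP[i si [->]]; exact: hs.
move=> h; split; first by have := h 0%N; apply; rewrite /= inE.
move=> j /= sj; have := h j.+1; apply.
by rewrite /= inE/= map_f.
Qed.

(** [B n.+1] depends on the pair [(B n, X n)], so independence on rectangles must be extended to all
    measurable sets of the plane. The factor [P C] is carried along as a scaling instead of
    conditioning on [C], which may have probability 0. *)
Let joint (n : nat) (C : set T) : measurable C ->
  (forall A1 A2 : set R, measurable A1 -> measurable A2 ->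
    P (B n @^-1` A1 `&` (X n @^-1` A2 `&` C)) =
    (P C * (P (B n @^-1` A1) * P (X n @^-1` A2)))%E) ->
  forall E : set (R * R), measurable E ->
    P ((fun t => (B n t, X n t)) @^-1` E `&` C) =
    (P C * (distribution P (B n) \x exp_law) E)%E.
Proof.
move=> mC rect E mE.
have c0 : 0 <= fine (P C) by exact: fine_ge0.
have cE : (fine (P C))%:E = P C by rewrite fineK// fin_num_measure.
pose phi : T -> R * R := fun t => (B n t, X n t).
have mphi : measurable_fun setT phi by exact: measurable_fun_pair.
pose m1_ : {measure set (R * R) -> \bar R} :=
  pushforward (mrestr P mC) phi.
pose m1 := m1_ mphi.
pose m2 : {measure set (R * R) -> \bar R} :=
  mscale (NngNum c0) (distribution P (B n) \x exp_law)%E.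
have m2E F : m2 F = (P C * (distribution P (B n) \x exp_law) F)%E.
  by rewrite /m2/= /mscale/= cE.
rewrite -m2E; change (m1 E = m2 E).
pose G : set (set (R * R)) := [set D | exists A1, measurable A1 /\
  exists A2, measurable A2 /\ D = A1 `*` A2].
apply: (measure_unique G (fun=> setT)) => //.
- rewrite measurable_prod_measurableType //; congr (<<s _ >>).
  rewrite predeqE; split => [[A1 mA1 [A2 mA2 <-]]|[A1 [mA1 [A2 [mA2 ->]]]]].
    by exists A1; split => //; exists A2.
  by exists A1 => //; exists A2.
- move=> _ _ [X1 [mX1 [X2 [mX2 ->]]]] [Y1 [mY1 [Y2 [mY2 ->]]]].
  rewrite -setXI; exists (X1 `&` Y1); split; first exact: measurableI.
  by exists (X2 `&` Y2); split => //; exact: measurableI.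
- move=> _; exists setT; split => //; exists setT; split => //.
  by rewrite setXTT.
- by rewrite bigcup_const//; exists 0%N.
- move=> _ [A1 [mA1 [A2 [mA2 ->]]]].
  rewrite m2E product_measure1E//=.
  have -> : m1 (A1 `*` A2) = P (B n @^-1` A1 `&` (X n @^-1` A2 `&` C)).
    by rewrite setIA.
  rewrite rect//; congr (_ * (_ * _))%E; exact: X_exponential.
- move=> k; rewrite /m1/= /pushforward /mrestr preimage_setT setTI.
  by rewrite (le_lt_trans (probability_le1 _ mC))// ltry.
Qed.

(** The law of [B n.+1] is left as a product measure. With [s] empty this identifies that law, and
    then yields both the next case of the invariant and [chain_evolves]. *)
Let indep_futureS (n : nat) : indep_future n ->
  forall (A0 : set R) (s : seq nat) (A : nat -> set R),
  measurable A0 -> uniq s -> (forall i, i \in s -> (n < i)%N) ->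
  (forall i, measurable (A i)) ->
  P (B n.+1 @^-1` A0 `&` cyl s A) =
  ((distribution P (B n) \x exp_law)
     ((fun z : R * R => storage_step M K z.1 z.2) @^-1` A0) *
   \prod_(i <- s) P (X i @^-1` A i))%E.
Proof.
move=> IH A0 s A mA0 us sn mA.
have cylE : P (cyl s A) = (\prod_(i <- s) P (X i @^-1` A i))%E.
  have := IH setT s A measurableT us (fun i si => ltnW (sn i si)) mA.
  rewrite preimage_setT setTI => ->.
  by rewrite (_ : P setT = 1%E) ?mul1e//; exact: probability_setT.
have rect A1 A2 : measurable A1 -> measurable A2 ->
    P (B n @^-1` A1 `&` (X n @^-1` A2 `&` cyl s A)) =
    (P (cyl s A) * (P (B n @^-1` A1) * P (X n @^-1` A2)))%E.
  (* All indices in [s] exceed [n], so slot [n] of the family is free to hold the constraint on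
     [X n]. *)
  move=> mA1 mA2; pose A' i := if i == n then A2 else A i.
  have cyl' : cyl s A = cyl s A'.
    apply/seteqP; split => t h i /= si; have := h i si;
      by rewrite /A' (gtn_eqF (sn i si)).
  have -> : X n @^-1` A2 `&` cyl s A = cyl (n :: s) A'.
    by rewrite cyl_cons -cyl' /A' eqxx.
  have ns : n \notin s by apply/negP => /sn; rewrite ltnn.
  rewrite IH//; last 3 first.
  - by rewrite /= ns.
  - by move=> i; rewrite inE => /predU1P[->//|/sn /ltnW].
  - by move=> i; rewrite /A'; case: ifP.
  rewrite big_cons {1}/A' eqxx cylE muleA muleC; congr (_ * _)%E.
  apply: eq_big_seq => i si; by rewrite /A' (gtn_eqF (sn i si)).
have mstep : measurable ((fun z : R * R => storage_step M K z.1 z.2) @^-1` A0).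
  by rewrite -[X in measurable X]setTI; exact: measurable_step.
have := joint (measurable_cyl s mA) rect mstep.
rewrite muleC cylE => <-; congr (P (_ `&` _)).
by apply/seteqP; split => t /=; rewrite B_rec.
Qed.

Let indep_future_all (n : nat) : indep_future n.
Proof.
elim: n => [|n IH]; first exact: indep_future0.
move=> A0 s A mA0 us sn mA; rewrite (indep_futureS IH)//.
have := indep_futureS IH (s := [::]) (A := A) mA0 isT (fun i => _) mA.
rewrite big_nil mule1 => <-//.
rewrite (_ : cyl [::] A = setT) ?setIT//.
by apply/seteqP; split.
Qed.

Lemma chain_evolves (n : nat) :
  evolves M K lambda (distribution P (B n)) (distribution P (B n.+1)).
Proof.
move=> A mA.
have := indep_futureS (@indep_future_all n) (s := [::]) (A := fun=> setT)
  mA isT (fun i => _) (fun=> measurableT).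
rewrite big_nil mule1 (_ : cyl [::] _ = setT) ?setIT; last first.
  by apply/seteqP; split.
move=> /(_ (fun i => _)) h; rewrite [RHS]h//.
rewrite /product_measure1.
by apply: eq_integral => b _; exact: storage_kernelE.
Qed.

End chain.

(** * The explicit formulas *)

Section formulas.
Context {R : realType}.
Variables (M lambda : R) (m : nat).
Hypotheses (M_gt0 : 0 < M) (lambda_gt0 : 0 < lambda).
Let K : R := m.+2%:R * M.
Let delta : R := lambda * M.
Notation tail_poly := (tail_poly M K lambda).
Notation tail := (tail M lambda m).
Notation density := (buffer_density M lambda m).

Lemma buffer_density_bottomE (x : R) : 0 <= x < M ->
  density x = lambda * (expR (- delta * (1 - m.+2%:R)) *
    \sum_(0 <= q < m.+1) expR (- delta * q%:R) / q`!%:R *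
      ((delta * (q%:R + 1) - lambda * K) ^+ q -
       expR (- lambda * x) * (delta * (q%:R + 1) + lambda * (x - K)) ^+ q)).
Proof.
move=> x0M; rewrite (buffer_density_bottom m M_gt0 lambda_gt0 x0M); congr (_ * _).
rewrite /tail_poly -sumrB mulr_sumr big_mkord; apply: eq_bigr => q _.
rewrite /tail_term.
have -> : - (lambda * (M - m.+2%:R * M)) - lambda * M * q%:R =
  - delta * (1 - m.+2%:R) + - delta * q%:R by rewrite /delta; ring.
have -> : - (lambda * (x + M - m.+2%:R * M)) - lambda * M * q%:R =
  - delta * (1 - m.+2%:R) + - delta * q%:R + - lambda * x by rewrite /delta; ring.
rewrite !expRD.
have -> : lambda * M * q%:R + lambda * (M - m.+2%:R * M) =
  delta * (q%:R + 1) - lambda * K by rewrite /delta /K; ring.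
have -> : lambda * M * q%:R + lambda * (x + M - m.+2%:R * M) =
  delta * (q%:R + 1) + lambda * (x - K) by rewrite /delta /K; ring.
by ring.
Qed.

(** Term [q.+1] at [x] and term [q] at [x + M] share the exponential and the [q]-th power, so their
    difference is a single summand. *)
Lemma buffer_density_cellE (n : nat) (x : R) : (n <= m)%N ->
  K - n.+1%:R * M <= x < K - n%:R * M ->
  density x = lambda * (expR (- lambda * (x - K)) *
    (1 + \sum_(1 <= q < n.+1) expR (- delta * q%:R) / (q - 1)`!%:R *
      (delta * q%:R + lambda * (x - K)) ^+ (q - 1) *
      (lambda * (x - K) / q%:R + delta - 1))).
Proof.
move=> nm xn; rewrite (buffer_density_cell M_gt0 lambda_gt0 nm xn).
congr (_ * _); rewrite /tail_poly -/K big_ord_recl/= -addrA -sumrB.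
rewrite big_add1 big_mkord/= mulrDr mulr1 mulr_sumr; congr (_ + _).
  rewrite /tail_term expr0 fact0 invr1 !mulr1; congr expR; ring.
apply: eq_bigr => q _; rewrite /tail_term /bump/= add1n subn1/=.
have -> : - (lambda * (x - K)) - lambda * M * q.+1%:R =
  - lambda * (x - K) + - delta * q.+1%:R by rewrite /delta; ring.
have -> : - (lambda * (x + M - K)) - lambda * M * q%:R =
  - lambda * (x - K) + - delta * q.+1%:R by rewrite /delta -natr1; ring.
have -> : lambda * M * q%:R + lambda * (x + M - K) =
  delta * q.+1%:R + lambda * (x - K) by rewrite /delta -natr1; ring.
rewrite expRD exprS factS natrM -/delta.
have : q.+1%:R != 0 :> R by rewrite pnatr_eq0.
have : q`!%:R != 0 :> R by rewrite pnatr_eq0 -lt0n fact_gt0.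
move=> v0 u0; suff h (e1 e2 w y u v : R) : u != 0 -> v != 0 ->
    e1 * e2 * ((delta * u + y) * w) / (u * v) - e1 * e2 * w / v =
    e1 * (e2 / v * w * (y / u + delta - 1)) by exact: h.
by move=> {}u0 {}v0; field; rewrite u0 v0.
Qed.

Let tail_poly_grid (n j : nat) : tail_poly n (K - j%:R * M) =
  expR (j%:R * delta) *
  \sum_(0 <= q < n) (delta * expR (- delta)) ^+ q / q`!%:R * (q%:R - j%:R) ^+ q.
Proof.
rewrite /tail_poly big_mkord mulr_sumr; apply: eq_bigr => q _.
rewrite /tail_term.
have -> : - (lambda * (K - j%:R * M - K)) - lambda * M * q%:R =
  j%:R * delta + q%:R * - delta by rewrite /delta; ring.
have -> : lambda * M * q%:R + lambda * (K - j%:R * M - K) =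
  delta * (q%:R - j%:R) by rewrite /delta; ring.
by rewrite expRD [expR (q%:R * _)]expRM_natl !exprMn; ring.
Qed.

(** Telescoping of [tail] over the cells from [K] down to [M]. Each increment is computed at both
    ends with the formula of one cell, which gives the two powers in the inner sum. *)
Lemma tail_baseE : tail M = 1 +
  \sum_(0 <= n < m.+1) expR (n%:R * delta) *
    \sum_(0 <= q < n.+1) (delta * expR (- delta)) ^+ q / q`!%:R *
      (expR delta * (q%:R - (n%:R + 1)) ^+ q - (q%:R - n%:R) ^+ q).
Proof.
have -> : tail M = tail K + (tail (K - m.+1%:R * M) - tail (K - 0%:R * M)).
  rewrite mul0r subr0 addrC subrK /K; congr tail.
  by rewrite -[in RHS]natr1; ring.
rewrite (tailK m M_gt0 lambda_gt0).
rewrite -(telescope_sumr (fun n => tail (K - n%:R * M)) (leq0n m.+1)).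
congr (_ + _); apply: eq_big_nat => n /andP[_ nm].
have le1 : K - n.+1%:R * M <= K - n%:R * M.
  by rewrite lerD2l lerN2 ler_pM2r// ler_nat.
have nm' : (n < m.+2)%N by exact: leqW.
have -> : tail (K - n.+1%:R * M) = tail_poly n.+1 (K - n.+1%:R * M).
  by apply: (tail_cell M_gt0 lambda_gt0 nm'); rewrite lexx le1.
have -> : tail (K - n%:R * M) = tail_poly n.+1 (K - n%:R * M).
  by apply: (tail_cell M_gt0 lambda_gt0 nm'); rewrite lexx le1.
rewrite !tail_poly_grid -[in X in expR X * _ - _]natr1 mulrDl mul1r expRD.
rewrite -mulrA -mulrBr; congr (_ * _); rewrite mulr_sumr -sumrB.
by apply: eq_bigr => q _; rewrite natr1; ring.
Qed.

Lemma tail_base_ge1 : 1 <= tail M.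
Proof.
rewrite -[X in X <= _](tailK m M_gt0 lambda_gt0).
have MK : M <= K.
  by rewrite /K -natr1 mulrDl mul1r lerDr mulr_ge0// ltW.
have := integral_density M_gt0 lambda_gt0 (lexx M) MK (lexx K).
move=> E; have : (0 <= (tail M - tail K)%:E)%E.
  rewrite -E; apply: integral_ge0 => x /=; rewrite in_itv/= => /andP[Mx xK].
  by rewrite lee_fin buffer_density_ge0// (le_trans (ltW M_gt0) Mx).
by rewrite lee_fin subr_ge0.
Qed.

End formulas.

(** * The upper incomplete gamma function at integer order *)

Section gamma.
Context {R : realType}.
Notation leb := (@lebesgue_measure R).

Lemma is_derive_expN (x : R) :
  is_derive x 1 (fun x => expR (- x)) (- expR (- x)).
Proof.
by rewrite -mulN1r; exact: (is_derive_exp (is_deriveNid x 1)).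
Qed.

(** The closed form of the incomplete gamma function obtained by repeated integration by parts; it
    makes sense for negative [z] as well. *)
Definition gamma_poly (q : nat) (z : R) : R :=
  expR (- z) * \sum_(k < q.+1) q`!%:R / k`!%:R * z ^+ k.

Lemma gamma_polyS (q : nat) (z : R) :
  gamma_poly q.+1 z = expR (- z) * z ^+ q.+1 + q.+1%:R * gamma_poly q z.
Proof.
rewrite /gamma_poly big_ord_recr/= mulfV ?pnatr_eq0 -?lt0n ?fact_gt0// mul1r.
rewrite mulrDr addrC; congr (_ + _); rewrite mulrCA; congr (_ * _).
rewrite mulr_sumr; apply: eq_bigr => k _.
by rewrite factS natrM !mulrA.
Qed.

Lemma is_derive_gamma_poly (q : nat) (z : R) :
  is_derive z 1 (gamma_poly q) (- (z ^+ q * expR (- z))).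
Proof.
have De : is_derive z 1 (fun z : R => expR (- z)) (-1 * expR (- z)).
  by rewrite mulN1r; exact: is_derive_expN.
elim: q => [|q IH].
  apply: (@is_derive_ext _ (fun z : R => expR (- z)) _ _ _ _ (is_derive_eq De _)).
    by move=> y; rewrite /gamma_poly big_ord1 fact0 divr1 expr0 !mulr1.
  by rewrite expr0 mul1r mulN1r.
have Did : is_derive z 1 (fun z : R => z) 1 by exact: is_derive_id.
have D := is_derive_add (is_derive_mul De (is_derive_expr q Did))
  (is_derive_mull q.+1%:R IH).
apply: (@is_derive_ext _ _ _ _ _ _ (is_derive_eq D _)) => [y|].
  by rewrite gamma_polyS.
by ring.
Qed.

Let cvg_pow_expR (k : nat) : z ^+ k * expR (- z) @[z --> +oo] --> (0 : R).
Proof.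
(* The upper bound comes from keeping the term of degree [k.+1] in the exponential series. *)
apply: (@squeeze_cvgr _ _ _ _ (cst 0) (fun z => (k.+1)`!%:R * z^-1)).
- near=> z.
  have z0 : 0 < z by near: z; exact: nbhs_pinfty_gt.
  rewrite mulr_ge0 ?exprn_ge0 ?expR_ge0 ?(ltW z0)//=.
  rewrite expRN ler_pdivrMr ?expR_gt0// mulrAC ler_pdivlMr// -exprSr.
  have := expR_ge1Dxn k (ltW z0).
  have f0 : 0 < (k.+1)`!%:R :> R by rewrite ltr0n fact_gt0.
  move=> h; rewrite -ler_pdivrMl// mulrC; apply: le_trans h.
  by rewrite lerDr.
- exact: cvg_cst.
- rewrite -[X in _ --> X](mulr0 (k.+1)`!%:R); apply: cvgMr.
  apply/gtr0_cvgV0; last exact: cvg_id.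
  by near=> z; near: z; exact: nbhs_pinfty_gt.
Unshelve. all: by end_near. Qed.

Lemma cvg_gamma_poly (q : nat) : gamma_poly q z @[z --> +oo] --> (0 : R).
Proof.
elim: q => [|q IH].
  have -> : gamma_poly 0 = fun z => z ^+ 0 * expR (- z).
    apply/funext => z.
    by rewrite /gamma_poly big_ord1 fact0 divr1 !expr0 mulr1 mul1r mulr1.
  exact: cvg_pow_expR.
have -> : gamma_poly q.+1 =
    fun z => z ^+ q.+1 * expR (- z) + q.+1%:R * gamma_poly q z.
  by apply/funext => z; rewrite gamma_polyS mulrC.
rewrite -[X in _ --> X](addr0 0); apply: cvgD; first exact: cvg_pow_expR.
by rewrite -[X in _ --> X](mulr0 q.+1%:R); exact: cvgMr IH.
Unshelve. all: by end_near. Qed.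

Let derive_opp_gamma (q : nat) (z : R) :
  is_derive z 1 (fun z => - gamma_poly q z) (z ^+ q * expR (- z)).
Proof.
have D := is_derive_mull (-1) (is_derive_gamma_poly q z).
apply: (@is_derive_ext _ _ _ _ _ _ (is_derive_eq D _)) => [y|].
  by rewrite mulN1r.
by rewrite mulN1r opprK.
Qed.

Let cont_integrand (q : nat) : continuous (fun z : R => z ^+ q * expR (- z)).
Proof.
move=> z; apply: cvgM; first exact: exprn_continuous.
exact: is_derive_continuous (is_derive_expN z).
Qed.

Lemma upper_gammaE (q : nat) (z : R) : upper_gamma q.+1 z = gamma_poly q z.
Proof.
have ge0E (y : R) : 0 <= y ->
    (\int[leb]_(t in `[y, +oo[) (t ^+ q * expR (- t))%:E =
     (gamma_poly q y)%:E)%E.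
  move=> y0; rewrite (@ge0_continuous_FTC2y _ _ (fun z => - gamma_poly q z) _ 0)//.
  - by rewrite sub0e -EFinN opprK.
  - by move=> x yx; rewrite mulr_ge0 ?expR_ge0// exprn_ge0// (le_trans y0).
  - by apply: continuous_subspaceT; exact: cont_integrand.
  - by rewrite -[X in _ --> X]oppr0; apply: cvgN; exact: cvg_gamma_poly.
  - by move=> x _; case: (derive_opp_gamma q x).
  - apply: cvg_at_right_filter; exact: is_derive_continuous (derive_opp_gamma q y).
  - by move=> x _; rewrite derive1E; exact: derive_val.
rewrite /upper_gamma /Rintegral/=.
have [z0|z0] := leP 0 z; first by rewrite ge0E.
(* For [z < 0] the integrand may be negative on [z, 0), while the improper integral is computed for
   nonnegative integrands. The cut at 0 leaves a bounded interval for the signed part. *)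
have -> : `[z, +oo[%classic = `[z, 0[ `|` `[0, +oo[ :> set R.
  apply/seteqP; split => x /=; rewrite !in_itv/= !andbT.
    by case: (ltP x 0) => x0 zx; [left|right]; rewrite ?zx.
  by case=> [/andP[]//|]; exact: le_trans (ltW z0).
have mf : measurable_fun [set: R] (fun t : R => (t ^+ q * expR (- t))%:E).
  by apply/measurable_EFinP; exact: continuous_measurable_fun.
rewrite integral_setU//.
- rewrite ge0E// (integral_is_derive (ltW z0) (derive_opp_gamma q));
    last exact: cont_integrand.
  by rewrite -EFinD/= opprK addrAC addNr add0r.
- exact: measurable_funTS.
- apply/disj_setPLR => x /=; rewrite !in_itv/= !andbT => /andP[_ x0] x0'.
  by move: x0; rewrite ltNge x0'.
Qed.

End gamma.

(** * The mass below [M], relative to the atom *)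

Section bottom_mass.
Context {R : realType}.
Variables (M lambda : R) (m : nat).
Hypotheses (M_gt0 : 0 < M) (lambda_gt0 : 0 < lambda).
Let K : R := m.+2%:R * M.
Let delta : R := lambda * M.
Notation density := (buffer_density M lambda m).
Notation leb := (@lebesgue_measure R).

Definition bottom_mass : R := expR (- delta * (1 - m.+2%:R)) *
  \sum_(0 <= q < m.+1) expR (- delta * q%:R) / q`!%:R *
    (expR (delta * (q%:R + 1 - m.+2%:R)) *
       (upper_gamma q.+1 (delta * (q%:R + 2 - m.+2%:R)) -
        upper_gamma q.+1 (delta * (q%:R + 1 - m.+2%:R))) +
     delta * (delta * (q%:R + 1 - m.+2%:R)) ^+ q).

Lemma integral_bottom :
  (\int[leb]_(x in `[0%R, M[) (density x)%:E = bottom_mass%:E)%E.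
Proof.
(* The substitution that turns exp (- lambda x) times the power into the gamma integrand. It maps 0
   and [M] to the two arguments of [upper_gamma], and the prefactor is what remains of exp (- lambda
   x) after splitting off exp (- z). *)
pose zq (q : nat) (x : R) := lambda * x + (delta * (q%:R + 1) - lambda * K).
pose Jq (q : nat) (x : R) := expR (- delta * q%:R) / q`!%:R *
  (expR (delta * (q%:R + 1 - m.+2%:R)) * gamma_poly q (zq q x) +
   (lambda * (delta * (q%:R + 1 - m.+2%:R)) ^+ q) * x).
pose wq (q : nat) (x : R) := expR (- delta * q%:R) / q`!%:R *
  (expR (delta * (q%:R + 1 - m.+2%:R)) *
     (- (zq q x ^+ q * expR (- zq q x)) * lambda) +
   lambda * (delta * (q%:R + 1 - m.+2%:R)) ^+ q).
have dJq q (x : R) : is_derive x 1 (Jq q) (wq q x).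
  apply: is_derive_mull; apply: is_derive_add.
    apply: is_derive_mull.
    have Dz : is_derive x 1 (zq q) lambda by exact: is_derive_affine.
    exact: (@is_derive1_comp _ (gamma_poly q) (zq q) x _ _
      (is_derive_gamma_poly q (zq q x)) Dz).
  have D := is_derive_affine (lambda * (delta * (q%:R + 1 - m.+2%:R)) ^+ q) 0 x.
  by apply: (@is_derive_ext _ _ _ _ _ _ D) => y; exact: addr0.
have dJ n (x : R) : is_derive x 1 (fun x => \sum_(0 <= q < n) Jq q x)
    (\sum_(0 <= q < n) wq q x).
  elim: n => [|n IH].
    apply: (@is_derive_ext _ (fun=> 0)) => [y|]; first by rewrite big_geq.
    by rewrite big_geq//; exact: is_derive_const.
  apply: (@is_derive_ext _ (fun x => \sum_(0 <= q < n) Jq q x + Jq n x)) => [y|].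
    by rewrite big_nat_recr.
  by rewrite big_nat_recr//=; exact: is_derive_add.
have cw n : continuous (fun x => \sum_(0 <= q < n) wq q x).
  elim: n => [|n IH].
    rewrite (_ : (fun _ => _) = fun=> 0); first exact: cst_continuous.
    by apply/funext => x; rewrite big_geq.
  rewrite (_ : (fun _ => _) = fun x => \sum_(0 <= q < n) wq q x + wq n x).
    move=> x; apply: cvgD; first exact: IH.
    have cz : continuous (zq n).
      by move=> y; exact: is_derive_continuous (is_derive_affine _ _ y).
    apply: cvgMr; apply: cvgD; last exact: cvg_cst.
    apply: cvgMr; apply: cvgMl; apply: cvgN.
    apply: cvgM.
      apply: (@continuous_comp _ _ _ (zq n) (fun y : R => y ^+ n)).
        exact: cz.
      exact: exprn_continuous.
    apply: (@continuous_comp _ _ _ (fun x => - zq n x) expR).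
      by apply: cvgN; exact: cz.
    exact: continuous_expR.
  by apply/funext => x; rewrite big_nat_recr.
pose c := expR (- delta * (1 - m.+2%:R)).
have dcJ (x : R) := is_derive_mull c (dJ m.+1 x).
transitivity (\int[leb]_(x in `[0%R, M[) (c * \sum_(0 <= q < m.+1) wq q x)%:E)%E.
  apply: eq_integral => x; rewrite inE/= in_itv/= => x0M; congr EFin.
  rewrite (buffer_density_bottomE m M_gt0 lambda_gt0 x0M) mulrCA; congr (_ * _).
  rewrite mulr_sumr; apply: eq_bigr => q _; rewrite /wq mulrCA; congr (_ * _).
  have -> : expR (- lambda * x) =
      expR (delta * (q%:R + 1 - m.+2%:R)) * expR (- zq q x).
    by rewrite -expRD; congr expR; rewrite /zq /delta /K; ring.
  have -> : delta * (q%:R + 1) - lambda * (m.+2%:R * M) =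
      delta * (q%:R + 1 - m.+2%:R) by rewrite /delta; ring.
  have -> : delta * (q%:R + 1) + lambda * (x - m.+2%:R * M) = zq q x.
    by rewrite /zq /K /delta; ring.
  by ring.
rewrite (integral_is_derive (ltW M_gt0) dcJ); last first.
  by move=> x; apply: cvgMr; exact: cw.
congr EFin; rewrite -mulrBr; congr (_ * _); rewrite -sumrB.
apply: eq_bigr => q _; rewrite /Jq -mulrBr; congr (_ * _).
rewrite !upper_gammaE.
have -> : zq q M = delta * (q%:R + 2 - m.+2%:R) by rewrite /zq /delta /K; ring.
have -> : zq q 0 = delta * (q%:R + 1 - m.+2%:R) by rewrite /zq /delta /K; ring.
by rewrite /delta; ring.
Qed.

Lemma bottom_mass_ge0 : 0 <= bottom_mass.
Proof.
rewrite -lee_fin -integral_bottom; apply: integral_ge0 => x /=.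
rewrite in_itv/= lee_fin => /andP[x0 xM]; rewrite buffer_density_ge0// x0/=.
by rewrite (lt_le_trans xM)// ler_peMl ?(ltW M_gt0)// ler1n.
Qed.

End bottom_mass.

(** * The stationary law *)

Section stationary_law.
Context {R : realType}.
Variables (M lambda : R) (m : nat).
Hypotheses (M_gt0 : 0 < M) (lambda_gt0 : 0 < lambda).
Let K : R := m.+2%:R * M.
Notation density := (buffer_density M lambda m).
Notation tail := (tail M lambda m).
Notation leb := (@lebesgue_measure R).

(** Normalisation: relative to the atom, [tail M] is the mass of [M, K], atom included, and
    [bottom_mass] that of [0, M). *)
Definition full_prob : R := (tail M + bottom_mass M lambda m)^-1.

Let M_ge0 : 0 <= M. Proof. exact: ltW. Qed.

Let MM_le_K : M + M <= K.
Proof.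
have : 2%:R * M <= K by rewrite ler_wpM2r// ler_nat.
by rewrite mulr_natl mulr2n.
Qed.

Let K_gt0 : 0 < K.
Proof. by apply: lt_le_trans MM_le_K; rewrite addr_gt0. Qed.

Lemma full_prob_gt0 : 0 < full_prob.
Proof.
rewrite invr_gt0 ltr_wpDr ?bottom_mass_ge0//.
exact: lt_le_trans ltr01 (tail_base_ge1 m M_gt0 lambda_gt0).
Qed.

(** Cut off outside (0, K) because [density_measure] asks for nonnegativity on the whole line, which
    is established for [buffer_density] on [0, K) only. *)
Definition stationary_density (x : R) : R :=
  if 0 < x < K then full_prob * density x else 0.

Lemma stationary_density_ge0 (x : R) : 0 <= stationary_density x.
Proof.
rewrite /stationary_density; case: ifPn => // /andP[x0 xK].
by rewrite mulr_ge0 ?(ltW full_prob_gt0)// buffer_density_ge0// (ltW x0).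
Qed.

Lemma measurable_stationary_density : measurable_fun setT stationary_density.
Proof.
apply: measurable_fun_ifT => //.
  by apply: measurable_and => //; exact: measurable_fun_ltr.
by apply: measurable_funM => //; exact: measurable_buffer_density.
Qed.

Definition stationary_measure := atomic_measure K
  (NngNum (ltW full_prob_gt0)) stationary_density_ge0
  measurable_stationary_density.

HB.instance Definition _ := Measure.on stationary_measure.

Let mdensity : measurable_fun [set: R] density.
Proof. exact: measurable_buffer_density. Qed.

Lemma integral_stationary (k : R -> R) :
  measurable_fun setT k -> (forall x, 0 <= k x) ->
  (\int[stationary_measure]_x (k x)%:E = full_prob%:E *
     (\int[leb]_(x in `[0%R, K[) (density x * k x)%:E + (k K)%:E))%E.
Proof.
move=> mk k0.
have mdk : measurable_fun [set: R] (fun x : R => (density x * k x)%:E).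
  by apply/measurable_EFinP; exact: measurable_funM.
have dk0 x : 0 <= x < K -> (0 <= (density x * k x)%:E)%E.
  by move=> x0; rewrite lee_fin mulr_ge0// buffer_density_ge0.
have mkE : measurable_fun [set: R] (fun x => (k x)%:E) by exact/measurable_EFinP.
have kE0 x : (0 <= (k x)%:E)%E by rewrite lee_fin.
rewrite integral_atomic_measure//.
have I0 : (0 <= \int[leb]_(x in `[0%R, K[) (density x * k x)%:E)%E.
  by apply: integral_ge0 => x /=; rewrite in_itv/=; exact: dk0.
rewrite ge0_muleDr ?lee_fin//; congr (_ + _)%E.
rewrite -integral_itv_obnd_cbnd; last exact: measurable_funTS.
rewrite -ge0_integralZl//=; last 3 first.
- exact: measurable_funTS.
- move=> x /=; rewrite in_itv/= => /andP[x0 xK]; apply: dk0.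
  by rewrite (ltW x0).
- by rewrite lee_fin (ltW full_prob_gt0).
rewrite [RHS]integral_mkcond; apply: eq_integral => x _.
rewrite patchE mem_setE in_itv/= /stationary_density.
by case: ifPn => _; rewrite ?mulr0 ?mule0// -!EFinM; congr EFin; ring.
Qed.

Let integral_density_total :
  (\int[leb]_(x in `[0%R, K[) (density x)%:E =
   (bottom_mass M lambda m + (tail M - 1))%:E)%E.
Proof.
have MK : M <= K by apply: le_trans MM_le_K; rewrite lerDr.
rewrite (integral_itv_co_split (c := M)); last 3 first.
- by rewrite M_ge0.
- exact/measurable_EFinP.
- by move=> x x0; rewrite lee_fin buffer_density_ge0.
rewrite integral_bottom// (integral_density M_gt0 lambda_gt0 (lexx M) MK (lexx K)).
by rewrite (tailK m M_gt0 lambda_gt0).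
Qed.

Let integral_stationary1 (k : R -> R) :
  measurable_fun setT k -> (forall x, 0 <= k x) ->
  (forall x, 0 <= x <= K -> k x = 1) ->
  (\int[stationary_measure]_x (k x)%:E = 1)%E.
Proof.
move=> mk k0 k1; rewrite integral_stationary// k1; last by rewrite (ltW K_gt0) lexx.
under eq_integral => x.
  rewrite inE/= in_itv/= => /andP[x0 xK]; rewrite k1 ?x0 ?(ltW xK)// mulr1; over.
rewrite integral_density_total -EFinD -EFinM addrA subrK; congr _%:E.
by rewrite /full_prob addrC mulVf// -invr_eq0 gt_eqF// full_prob_gt0.
Qed.

Let stationary_measure_setT : stationary_measure setT = 1%E.
Proof.
rewrite -(@integral_stationary1 (fun=> 1))//.
by rewrite integral_cst// mul1e.
Qed.

HB.instance Definition _ := @Measure_isProbability.Build _ _ R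
  stationary_measure stationary_measure_setT.

Lemma stationary_measure_range : stationary_measure `[0, K]%classic = 1%E.
Proof.
rewrite -(@integral_stationary1 (\1_(`[0, K]%classic : set R))).
- by rewrite integral_indic// setIT.
- exact: measurable_indic.
- by [].
- by move=> x x0; rewrite indicE mem_setE in_itv/= x0.
Qed.

Lemma stationary_measureE (A : set R) : measurable A ->
  (stationary_measure A =
   \int[leb]_(x in A `&` `]0%R, K[) (full_prob * density x)%:E +
   full_prob%:E * \d_K A)%E.
Proof.
move=> mA; rewrite /stationary_measure /atomic_measure measure_addE.
congr (_ + _)%E; rewrite /density_measure [RHS]integral_mkcondr.
apply: eq_integral => x _; rewrite patchE mem_setE in_itv/=.
by rewrite /stationary_density; case: ifP.
Qed.

(** Agreement is required on the open interval only: the slot demand switches on strictly above [M],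
    so the weight [w x] may jump at [M], the left end of one of the pieces below. *)
Let eq_integral_co (a b : R) (f g : R -> R) :
  measurable_fun setT f -> measurable_fun setT g ->
  (forall x, a < x < b -> f x = g x) ->
  (\int[leb]_(x in `[a, b[) (f x)%:E = \int[leb]_(x in `[a, b[) (g x)%:E)%E.
Proof.
move=> mf mg fg.
rewrite -integral_itv_obnd_cbnd; last exact/measurable_funTS/measurable_EFinP.
rewrite -[RHS]integral_itv_obnd_cbnd; last exact/measurable_funTS/measurable_EFinP.
by apply: eq_integral => x; rewrite inE/= in_itv/= => /fg ->.
Qed.

Let mexp : measurable_fun [set: R] (fun x : R => density x * expR (lambda * x)).
Proof.
apply: measurable_funM => //; apply: continuous_measurable_fun => x.
have D := is_derive_exp (is_derive_mull lambda (is_derive_id x 1)).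
exact: is_derive_continuous D.
Qed.

Let integral_weight (a b c v : R) (k : R -> R) : measurable_fun setT k ->
  0 <= a -> b <= K ->
  (\int[leb]_(x in `[a, b[) (density x * expR (lambda * x))%:E = v%:E)%E ->
  (forall x, a < x < b -> k x = expR (lambda * x - c)) ->
  (\int[leb]_(x in `[a, b[) (density x * k x)%:E = (expR (- c) * v)%:E)%E.
Proof.
move=> mk a0 bK V kE.
rewrite (@eq_integral_co _ _ _
  (fun x => expR (- c) * (density x * expR (lambda * x)))); last 3 first.
- exact: measurable_funM.
- exact: measurable_funM.
- by move=> x /kE ->; rewrite expRD; ring.
under eq_integral do rewrite EFinM.
rewrite ge0_integralZl ?V ?EFinM//.
- exact/measurable_funTS/measurable_EFinP.
- move=> x /=; rewrite in_itv/= => /andP[ax xb].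
  rewrite lee_fin mulr_ge0 ?expR_ge0// buffer_density_ge0//.
  by rewrite (le_trans a0 ax) (lt_le_trans xb bK).
Qed.

Let integral_one (a b : R) (k : R -> R) : measurable_fun setT k ->
  (forall x, a < x < b -> k x = 1) ->
  (\int[leb]_(x in `[a, b[) (density x * k x)%:E =
   \int[leb]_(x in `[a, b[) (density x)%:E)%E.
Proof.
move=> mk k1; apply: eq_integral_co => //; first exact: measurable_funM.
by move=> x /k1 ->; rewrite mulr1.
Qed.

(* Probability that the content exceeds [x] after one slot started at [b]. *)
Let w (x b : R) : R :=
  expR (- (lambda * Num.max 0 (x - (b - M * (M < b)%R%:R)))).

Let mw x : measurable_fun setT (w x).
Proof.
have mlt : measurable_fun setT (fun b : R => (M < b)%R%:R : R).
  rewrite (_ : (fun _ => _) = fun b : R => if M < b then 1 else 0).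
    by apply: measurable_fun_ifT => //; exact: measurable_fun_ltr.
  by apply/funext => z; case: ifP.
apply: measurableT_comp => //; apply: measurableT_comp => //.
apply: measurable_funM => //; apply: measurable_maxr => //.
apply: measurable_funB => //; apply: measurable_funB => //.
exact: measurable_funM.
Qed.

Let w_below x b : b <= M -> b <= x -> w x b = expR (lambda * b - lambda * x).
Proof.
move=> bM bx; rewrite /w ltNge bM mulr0 subr0 max_r ?subr_ge0//.
by congr expR; ring.
Qed.

Let w_above x b : M < b -> b <= x + M ->
  w x b = expR (lambda * b - lambda * (x + M)).
Proof.
move=> bM bx; rewrite /w bM mulr1 max_r; last by lra.
by congr expR; ring.
Qed.

Let w1_below x b : b <= M -> x <= b -> w x b = 1.
Proof.
move=> bM bx; rewrite /w ltNge bM mulr0 subr0 max_l ?subr_le0//.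
by rewrite mulr0 oppr0 expR0.
Qed.

Let w1_above x b : M < b -> x + M <= b -> w x b = 1.
Proof.
move=> bM bx; rewrite /w bM mulr1 max_l; last by lra.
by rewrite mulr0 oppr0 expR0.
Qed.

Let mdw x : measurable_fun [set: R] (fun b => (density b * w x b)%:E).
Proof. by apply/measurable_EFinP; exact: measurable_funM. Qed.

Let dw0 x b : 0 <= b < K -> (0 <= (density b * w x b)%:E)%E.
Proof. by move=> b0; rewrite lee_fin mulr_ge0 ?expR_ge0// buffer_density_ge0. Qed.

Let md : measurable_fun [set: R] (fun b => (density b)%:E).
Proof. exact/measurable_EFinP. Qed.

Let d0 b : 0 <= b < K -> (0 <= (density b)%:E)%E.
Proof. by move=> b0; rewrite lee_fin buffer_density_ge0. Qed.

(** On [0, x) and on [M, x + M) the weight is an exponential, elsewhere it is 1. The two exponential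
    pieces telescope: [tail 0] and [tail x], the values taken below [M], cancel between them, and
    [tail M - tail (x + M)] remains. *)
Let balance_low (x : R) : 0 <= x < M ->
  (\int[leb]_(b in `[0%R, K[) (density b * w x b)%:E + (w x K)%:E =
   \int[leb]_(b in `[x, K[) (density b)%:E + 1)%E.
Proof.
move=> /andP[x0 xM].
have xMK : x + M <= K by move: MM_le_K; lra.
have MxM : M <= x + M by lra.
have MK : M < K by move: MM_le_K; lra.
pose fw b := (density b * w x b)%:E.
have mfw : measurable_fun [set: R] fw by exact: mdw.
have fw0 b : 0 <= b < K -> (0 <= fw b)%E by exact: dw0.
rewrite (@integral_itv_co_split _ fw 0 x K) ?x0 ?(ltW (lt_trans xM MK))//.
rewrite (@integral_itv_co_split _ fw x M K) ?(ltW xM) ?(ltW MK)//;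
    last first.
  by move=> b /andP[xb bK]; apply: fw0; rewrite (le_trans x0 xb).
rewrite (@integral_itv_co_split _ fw M (x + M) K) ?MxM ?xMK//;
    last first.
  by move=> b /andP[xb bK]; apply: fw0; rewrite (le_trans M_ge0 xb).
rewrite [in RHS](integral_itv_co_split (c := M)) ?(ltW xM) ?(ltW MK)//; last first.
  by move=> b /andP[xb bK]; apply: d0; rewrite (le_trans x0 xb).
rewrite /fw (integral_weight (mw x) (lexx 0) (ltW (lt_trans xM MK))
  (integral_density_exp_bottom m M_gt0 lambda_gt0 (lexx 0) x0 (ltW xM))
  (c := lambda * x)); last first.
  by move=> b /andP[b0 bx]; rewrite w_below ?(ltW bx)// ltW// (lt_trans bx).
rewrite (integral_weight (mw x) M_ge0 xMK
  (integral_density_exp M_gt0 lambda_gt0 (lexx M) MxM xMK)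
  (c := lambda * (x + M))); last first.
  by move=> b /andP[Mb bx]; rewrite w_above// ltW.
rewrite (@integral_one x M)//; last first.
  by move=> b /andP[xb bM]; rewrite w1_below// ltW.
rewrite (@integral_one (x + M) K)//; last first.
  by move=> b /andP[xb bK]; rewrite w1_above ?(ltW xb)// (le_lt_trans MxM).
rewrite (integral_density M_gt0 lambda_gt0 MxM xMK (lexx K)).
rewrite (integral_density M_gt0 lambda_gt0 (lexx M) (ltW MK) (lexx K)).
rewrite w1_above//.
rewrite addeCA -!EFinD; congr (_ + _%:E + _)%E.
rewrite mulr0 expR0 subrr addrK.
have -> : expR (lambda * (x + M)) = expR (lambda * x) * expR (lambda * M).
  by rewrite -expRD; congr expR; ring.
have -> : expR (- (lambda * (x + M))) =
    (expR (lambda * x))^-1 * (expR (lambda * M))^-1.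
  by rewrite -!expRN -expRD; congr expR; ring.
rewrite expRN.
have := expR_gt0 (lambda * x); have := expR_gt0 (lambda * M).
move: (expR _) (expR _) => e1 e2 /lt0r_neq0 h1 /lt0r_neq0 h2.
by field; rewrite h1 h2.
Qed.

Let balance_high (x : R) : M <= x < K ->
  (\int[leb]_(b in `[0%R, K[) (density b * w x b)%:E + (w x K)%:E =
   \int[leb]_(b in `[x, K[) (density b)%:E + 1)%E.
Proof.
move=> /andP[Mx xK].
have MK : M < K by exact: le_lt_trans xK.
(* Contents above [x + M] stay above [x] whatever the inflow; if [x + M] exceeds [K] there are none,
   and even the atom has weight below 1. *)
pose z := Num.min (x + M) K.
have zK : z <= K by rewrite ge_min lexx orbT.
have zx : z <= x + M by rewrite ge_min lexx.
have Mz : M <= z by rewrite le_min (ltW MK) andbT lerDr (le_trans M_ge0).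
pose fw b := (density b * w x b)%:E.
have mfw : measurable_fun [set: R] fw by exact: mdw.
have fw0 b : 0 <= b < K -> (0 <= fw b)%E by exact: dw0.
rewrite (@integral_itv_co_split _ fw 0 M K) ?M_ge0 ?(ltW MK)//.
rewrite (@integral_itv_co_split _ fw M z K) ?Mz ?zK//;
    last first.
  by move=> b /andP[xb bK]; apply: fw0; rewrite (le_trans M_ge0 xb).
rewrite /fw (integral_weight (mw x) (lexx 0) (ltW MK)
  (integral_density_exp_bottom m M_gt0 lambda_gt0 (lexx 0) M_ge0 (lexx M))
  (c := lambda * x)); last first.
  by move=> b /andP[b0 bM]; rewrite w_below ?(ltW bM)// (le_trans (ltW bM)).
rewrite (integral_weight (mw x) M_ge0 zK
  (integral_density_exp M_gt0 lambda_gt0 (lexx M) Mz zK)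
  (c := lambda * (x + M))); last first.
  by move=> b /andP[Mb bx]; rewrite w_above// (le_trans (ltW bx)).
rewrite (@integral_one z K)//; last first.
  move=> b /andP[zb bK]; rewrite w1_above//; first exact: le_lt_trans Mz zb.
  by move: zb; rewrite gt_min => /orP[/ltW//|]; rewrite ltNge (ltW bK).
rewrite (integral_density M_gt0 lambda_gt0 Mz zK (lexx K)).
rewrite (integral_density M_gt0 lambda_gt0 Mx (ltW xK) (lexx K)).
rewrite (tailK m M_gt0 lambda_gt0) -!EFinD; congr (_%:E).
rewrite mulr0 expR0 mul1r !subrr mulr0.
have -> : expR (- (lambda * (x + M))) =
    expR (- (lambda * x)) * (expR (lambda * M))^-1.
  by rewrite -expRN -expRD; congr expR; ring.
have eM := lt0r_neq0 (expR_gt0 (lambda * M)).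
have [xMK|KxM] := leP (x + M) K.
  have zE : z = x + M by rewrite /z min_l.
  rewrite w1_above// zE addrK.
  have -> : expR (lambda * (x + M)) = expR (lambda * x) * expR (lambda * M).
    by rewrite -expRD; congr expR; ring.
  rewrite expRN; have ex := lt0r_neq0 (expR_gt0 (lambda * x)).
  by field; rewrite ex eM.
have zE : z = K by rewrite /z min_r// ltW.
rewrite zE w_above ?(ltW KxM)//.
(* Here [x] and [K - M] both lie in the top cell, where [tail] is a pure exponential, and the
   identity can be checked directly. *)
have cellx (y : R) : K - M <= y <= K -> tail y = expR (- (lambda * (y - K))).
  move=> yK; rewrite (@tail_cell _ M lambda m M_gt0 lambda_gt0 0)//; last first.
    by rewrite mul0r subr0 mul1r.
  rewrite /tail_poly big_ord1 /tail_term expr0 fact0 invr1 !mulr1.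
  by congr expR; rewrite /K /=; ring.
rewrite (cellx x); last by apply/andP; split; [lra|exact: ltW].
rewrite (cellx (K - M)); last by rewrite lexx/= lerBlDr lerDl.
rewrite (tailK m M_gt0 lambda_gt0).
have -> : expR (- (lambda * (K - M - K))) = expR (lambda * M).
  by congr expR; ring.
have -> : expR (- (lambda * (x - K))) = expR (- (lambda * x)) * expR (lambda * K).
  by rewrite -expRD; congr expR; ring.
have -> : expR (lambda * K - lambda * (x + M)) =
    expR (- (lambda * x)) * expR (lambda * K) * (expR (lambda * M))^-1.
  by rewrite -expRN -!expRD; congr expR; ring.
by field.
Qed.

Let balance (x : R) : x < K ->
  (\int[stationary_measure]_b (w x b)%:E =
   stationary_measure `]x, +oo[%classic)%E.
Proof.
move=> xK; rewrite integral_stationary//; last by move=> b; exact: expR_ge0.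
have mI : measurable_fun setT (\1_(`]x, +oo[%classic : set R) : R -> R).
  exact: measurable_indic.
have I0 b : 0 <= \1_(`]x, +oo[%classic : set R) b :> R by [].
rewrite -[in RHS](setIT `]x, +oo[%classic) -integral_indic//.
rewrite integral_stationary//; congr (_ * _)%E.
rewrite [X in (_ = _ + X%:E)%E]indicE mem_setE in_itv/= xK.
have [x0|x0] := ltP x 0.
  rewrite /w max_l; last first.
    by rewrite subr_le0; case: ltP; rewrite ?mulr1 ?mulr0; move: MM_le_K; lra.
  rewrite mulr0 oppr0 expR0; congr (_ + _)%E.
  apply: eq_integral => b; rewrite inE/= in_itv/= => /andP[b0 bK]; congr (_ * _)%:E.
  rewrite indicE mem_setE in_itv/= (lt_le_trans x0 b0)/=.
  rewrite max_l ?mulr0 ?oppr0 ?expR0//.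
  by rewrite subr_le0; case: ltP; rewrite ?mulr1 ?mulr0; lra.
have -> : (\int[leb]_(b in `[0%R, K[) (density b * w x b)%:E + (w x K)%:E =
   \int[leb]_(b in `[x, K[) (density b)%:E + 1)%E.
  have [xM|Mx] := ltP x M; first by apply: balance_low; rewrite x0.
  by apply: balance_high; rewrite Mx.
congr (_ + _)%E.
rewrite [RHS](integral_itv_co_split (c := x)) ?x0 ?(ltW xK)//; last 2 first.
- by apply/measurable_EFinP; exact: measurable_funM.
- by move=> b b0; rewrite lee_fin mulr_ge0// buffer_density_ge0.
rewrite [X in (_ = X + _)%E](_ : _ = 0%E) ?add0e; last first.
  apply: integral0_eq => b; rewrite /= in_itv/= => /andP[_ bx].
  by rewrite indicE mem_setE in_itv/= ltNge (ltW bx)/= mulr0.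
apply: eq_integral_co => //; first exact: measurable_funM.
by move=> b /andP[xb _]; rewrite indicE mem_setE in_itv/= xb mulr1.
Qed.

(** Rays compare two probabilities, so the image of the law must already be one; [evolves_total]
    supplies it. *)
Lemma stationary_evolves (mu' : probability R R) :
  evolves M K lambda stationary_measure mu' ->
  forall A, measurable A -> mu' A = stationary_measure A.
Proof.
move=> ev; apply: probability_eq_rays => x; rewrite -ev//.
have [xK|Kx] := ltP x K; last first.
  transitivity (0%E : \bar R); last first.
    have nC : stationary_measure (~` `[0, K]%classic) = 0%E.
      rewrite probability_setC// [X in (1 - X)%E]stationary_measure_range.
      by rewrite subee.
    apply/esym; apply: (@subset_measure0 _ _ _ _ _ (~` `[0, K]%classic)) => //.
    - exact: measurableC.
    - move=> y /=; rewrite !in_itv/= andbT => xy /andP[_ yK].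
      by move: xy; rewrite ltNge (le_trans yK).
  apply: integral0_eq => b _; rewrite /storage_kernel.
  rewrite (_ : _ @^-1` _ = set0) ?measure0//.
  apply/seteqP; split => y //=; rewrite in_itv/= andbT /storage_step lt_min.
  by move=> /andP[_]; rewrite ltNge Kx.
transitivity (\int[stationary_measure]_b (w x b)%:E)%E; last exact: balance.
apply: eq_integral => b _; rewrite /storage_kernel.
rewrite /w -exponential_prob_itvy//; congr (exponential_prob _ _).
apply/seteqP; split => y /=;
  rewrite !in_itv/= !andbT /storage_step lt_min xK andbT.
  by rewrite ltrBlDl.
by rewrite ltrBlDl.
Qed.

End stationary_law.

(** * Convergence and uniqueness *)

Section conclusion.
Context {R : realType}.
Variables (M K lambda : R).
Hypotheses (K_gt0 : 0 < K) (lambda_gt0 : 0 < lambda).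
Local Notation eps := (expR (- (lambda * K))).

Lemma evolves_total (mu : probability R R) :
  exists mu' : probability R R, evolves M K lambda mu mu'.
Proof.
pose f : {mfun (R * R)%type >-> R} := mfun_Sub (mem_set (measurable_step M K)).
exists (distribution (mu \x exponential_law lambda_gt0)%E f) => A mA.
rewrite /distribution /pushforward /= /product_measure1.
by apply: eq_integral => b _; rewrite (storage_kernelE _ _ lambda_gt0).
Qed.

Lemma contraction_bounds : 0 <= 1 - eps < 1.
Proof.
rewrite subr_ge0 ltW ?expR_lt1 ?oppr_lt0 ?mulr_gt0//=.
by rewrite gtrBl expR_gt0.
Qed.

Lemma tv_close_iter (mu nu : nat -> probability R R) :
  mu 0%N `[0, K]%classic = 1%E -> nu 0%N `[0, K]%classic = 1%E ->
  (forall n, evolves M K lambda (mu n) (mu n.+1)) ->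
  (forall n, evolves M K lambda (nu n) (nu n.+1)) ->
  forall n, tv_close (mu n) (nu n) ((1 - eps) ^+ n).
Proof.
move=> mu0 nu0 emu enu n.
have rmu k : mu k `[0, K]%classic = 1%E.
  elim: k => // k IH.
  exact (evolves_range K_gt0 lambda_gt0 IH (emu k)).
have rnu k : nu k `[0, K]%classic = 1%E.
  elim: k => // k IH.
  exact (evolves_range K_gt0 lambda_gt0 IH (enu k)).
have /andP[e0 _] := contraction_bounds.
elim: n => [|n IH]; first by rewrite expr0; exact: tv_close1.
rewrite exprS; apply: (tv_close_evolves K_gt0 lambda_gt0 _
  (rmu n) (rnu n) (emu n) (enu n) IH).
exact: exprn_ge0.
Qed.

Lemma cvg_contraction : (1 - eps) ^+ n @[n --> \oo] --> (0 : R).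
Proof.
have /andP[e0 e1] := contraction_bounds.
by apply: cvg_expr; rewrite ger0_norm.
Qed.

(** Stationary laws are constant orbits of the chain, so two of them are within [(1 - eps) ^+ n] of
    each other for every [n]. *)
Lemma stationary_unique (mu nu : probability R R) :
  stationary M K lambda mu -> stationary M K lambda nu ->
  forall A : set R, measurable A -> nu A = mu A.
Proof.
move=> smu snu A mA; apply/eqP; rewrite eq_le.
suff le (mu' nu' : probability R R) : stationary M K lambda mu' ->
    stationary M K lambda nu' -> (nu' A <= mu' A)%E.
  by rewrite !le.
move=> [mu1 emu] [nu1 enu].
have close n : fine (nu' A) <= fine (mu' A) + (1 - eps) ^+ n.
  rewrite -lee_fin EFinD !fineK ?fin_num_measure//.
  apply: tv_close_set => //.
  exact: (@tv_close_iter (fun=> nu') (fun=> mu') nu1 mu1 (fun=> enu) (fun=> emu)).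
rewrite -[leLHS]fineK ?fin_num_measure// -[leRHS]fineK ?fin_num_measure//.
have lim : fine (mu' A) + (1 - eps) ^+ n @[n --> \oo] --> fine (mu' A).
  rewrite -[X in _ --> X]addr0.
  by apply: cvgD; [exact: cvg_cst | exact: cvg_contraction].
by rewrite lee_fin; apply: (cvgr_to_ge lim); exact: nearW.
Qed.

Lemma tv_dist_cvg (mu : nat -> probability R R) (nu : probability R R) :
  mu 0%N `[0, K]%classic = 1%E -> stationary M K lambda nu ->
  (forall n, evolves M K lambda (mu n) (mu n.+1)) ->
  tv_dist (mu n) nu @[n --> \oo] --> (0 : R).
Proof.
move=> mu0 [nu0 enu] emu.
have c1 n : tv_close (mu n) nu ((1 - eps) ^+ n).
  exact: (@tv_close_iter mu (fun=> nu) mu0 nu0 emu (fun=> enu)).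
have c2 n : tv_close nu (mu n) ((1 - eps) ^+ n).
  exact: (@tv_close_iter (fun=> nu) mu nu0 mu0 (fun=> enu) emu).
have bound n A : measurable A ->
    `|fine (mu n A) - fine (nu A)| <= (1 - eps) ^+ n.
  move=> mA; rewrite ler_distl; apply/andP; split.
    rewrite lerBlDr -lee_fin EFinD !fineK ?fin_num_measure//.
    exact: tv_close_set.
  rewrite -lee_fin EFinD !fineK ?fin_num_measure//.
  exact: tv_close_set.
pose S n := [set `|fine (mu n A) - fine (nu A)| |
  A in (measurable : set (set R))].
(* The value 0, attained at the empty set, makes the supremum nonnegative and the set nonempty. *)
have S0 n : S n 0.
  by exists set0 => //; rewrite !measure0 subrr normr0.
have ubS n : ubound (S n) ((1 - eps) ^+ n).
  by move=> _ [A mA <-]; exact: bound.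
apply: (@squeeze_cvgr _ _ _ _ (cst 0) (fun n => (1 - eps) ^+ n)).
- apply: nearW => n; apply/andP; split.
    have hub : has_ubound (S n) by exists ((1 - eps) ^+ n).
    exact: ub_le_sup hub _ (S0 n).
  have S_neq0 : S n !=set0 by exists 0.
  exact: ge_sup S_neq0 (ubS n).
- exact: cvg_cst.
- exact: cvg_contraction.
Qed.

End conclusion.

Theorem corollary2 (R : realType) (M K Xbar lambda delta : R) (l : nat)
    (d : measure_display) (T : measurableType d) (P : probability T R)
    (X B : nat -> {RV P >-> R})
    (M_gt0 : 0 < M) (l_ge2 : (2 <= l)%N) (K_def : K = l%:R * M)
    (lambda_gt0 : 0 < lambda) (lambda_def : lambda = 1 / Xbar)
    (delta_def : delta = lambda * M)
    (X_exponential : forall (i : nat) (A : set R), measurable A ->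
       distribution P (X i) A = exponential_prob lambda A)
    (X_mean : forall i : nat, ('E_P[X i] = Xbar%:E)%E)
    (independence : mutually_independent (cons_family (B 0%N) X))
    (B0_range : forall t : T, 0 <= B 0%N t <= K)
    (B_rec : forall (i : nat) (t : T),
       B i.+1 t = storage_step M K (B i t) (X i t)) :
  exists (mu : probability R R) (g : R -> R) (piK : R),
    [/\ stationary M K lambda mu,
        (forall nu : probability R R, stationary M K lambda nu ->
           forall A : set R, measurable A -> nu A = mu A) &
        tv_dist (distribution P (B n)) mu @[n --> \oo] --> (0 : R)] /\
    [/\ has_density_and_atom K mu g piK,
        (forall x : R, 0 <= x < M ->
           g x = piK * lambda * expR (- delta * (1 - l%:R)) *
             \sum_(0 <= q < (l - 2).+1)
               expR (- delta * q%:R) / q`!%:R *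
               ((delta * (q%:R + 1) - lambda * K) ^+ q -
                expR (- lambda * x) *
                  (delta * (q%:R + 1) + lambda * (x - K)) ^+ q)),
        (forall n : nat, (n <= l - 2)%N ->
           forall x : R, K - (n%:R + 1) * M <= x < K - n%:R * M ->
           g x = piK * lambda * expR (- lambda * (x - K)) *
             (1 + \sum_(1 <= q < n.+1)
                expR (- delta * q%:R) / (q - 1)`!%:R *
                (delta * q%:R + lambda * (x - K)) ^+ (q - 1) *
                (lambda * (x - K) / q%:R + delta - 1))) &
        piK =
          (1
           + \sum_(0 <= n < (l - 2).+1) expR (n%:R * delta) *
               \sum_(0 <= q < n.+1)
                 (delta * expR (- delta)) ^+ q / q`!%:R *
                 (expR delta * (q%:R - (n%:R + 1)) ^+ q - (q%:R - n%:R) ^+ q)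
           + expR (- delta * (1 - l%:R)) *
               \sum_(0 <= q < (l - 2).+1)
                 expR (- delta * q%:R) / q`!%:R *
                 (expR (delta * (q%:R + 1 - l%:R)) *
                    (upper_gamma q.+1 (delta * (q%:R + 2 - l%:R)) -
                     upper_gamma q.+1 (delta * (q%:R + 1 - l%:R)))
                  + delta * (delta * (q%:R + 1 - l%:R)) ^+ q))^-1].
Proof.
case: l l_ge2 K_def => [//|[//|m]] _ KE.
rewrite delta_def KE in B_rec B0_range *.
have {KE} K_gt0 : 0 < m.+2%:R * M by rewrite mulr_gt0.
rewrite subSS subSS subn0.
pose mu := stationary_measure m M_gt0 lambda_gt0.
have emu : evolves M (m.+2%:R * M) lambda mu mu.
  have [mu' ev] := evolves_total M (m.+2%:R * M) lambda_gt0 mu.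
  by move=> A mA; rewrite ev// (stationary_evolves ev).
have smu : stationary M (m.+2%:R * M) lambda mu.
  by split => //; exact: stationary_measure_range.
exists mu, (fun x => full_prob M lambda m * buffer_density M lambda m x),
  (full_prob M lambda m); split.
  split => //.
    by move=> nu snu A mA; exact: stationary_unique smu snu A mA.
  apply: (tv_dist_cvg K_gt0 lambda_gt0 _ smu) => [|n].
    rewrite -(probability_setT P) /distribution /pushforward.
    congr (P _); apply/seteqP; split => t //= _.
    by rewrite in_itv/= B0_range.
  exact: (chain_evolves lambda_gt0 X_exponential independence B_rec).
split.
- split.
  + apply: measurable_funTS; apply: measurable_funM => //.
    exact: measurable_buffer_density.
  + move=> x /andP[x0 xK].
    rewrite mulr_ge0 ?(ltW (full_prob_gt0 _ _ _))//.
    by rewrite buffer_density_ge0// (ltW x0).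
  + by move=> A mA; exact: stationary_measureE.
- move=> x x0M; rewrite (buffer_density_bottomE m M_gt0 lambda_gt0 x0M).
  by rewrite !mulrA.
- move=> n nm x; rewrite natr1 => xn.
  by rewrite (buffer_density_cellE M_gt0 lambda_gt0 nm xn) !mulrA.
- by rewrite /full_prob /bottom_mass (tail_baseE m M_gt0 lambda_gt0).
Qed.
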